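(* In the setting of the context, let $i\in\{1,2\}$, let $(\boldsymbol\sigma,u)$ be the minimizer of $\mathcal L_i(\cdot,\cdot;f,g)$ over $\Sigma\times L^2(\Omega)$, and let $(\boldsymbol\sigma_h,u_h)$ be the minimizer of $\mathcal L_i(\cdot,\cdot;f,g)$ over $RT_k\times P_k$. Then, with $|\!|\!|\cdot|\!|\!|_B$ taken with the weight $\omega=\omega_i$, $$|\!|\!|(\boldsymbol\sigma-\boldsymbol\sigma_h,u-u_h)|\!|\!|_B\le\inf_{(\boldsymbol\tau_h,v_h)\in RT_k\times P_k}|\!|\!|(\boldsymbol\sigma-\boldsymbol\tau_h,u-v_h)|\!|\!|_B.$$
   Context: $\Omega\subset\mathbb R^d$ is a bounded polyhedral domain with Lipschitz boundary and unit outward normal $\mathbf n$. $\boldsymbol\beta\in[C^1(\overline\Omega)]^d$ and $\gamma\in L^\infty(\Omega)$ with $\gamma+\frac12\nabla\cdot\boldsymbol\beta\ge 0$. Set $\Gamma_-=\{x\in\partial\Omega:\boldsymbol\beta\cdot\mathbf n<0\}$ (inflow) and $\Gamma_+=\{x\in\partial\Omega:\boldsymbol\beta\cdot\mathbf n>0\}$ (outflow). It is assumed that $|\boldsymbol\beta\cdot\mathbf n|\ge c>0$ on $\Gamma_-$ for a constant $c$, and that one of the following holds: (i) $0<|\boldsymbol\beta|<C$ for a constant $C$; there is a transformation to a coordinate system in which the streamlines of $\boldsymbol\beta$ starting on $\Gamma_-$ are lined up with one coordinate direction $r$ and whose Jacobian is bounded; and every streamline connects $\Gamma_-$ and $\Gamma_+$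 with finite length; (ii) there is $\gamma_0>0$ with $\gamma+\frac12\nabla\cdot\boldsymbol\beta\ge\gamma_0$ in $\Omega$, and the inflow and outflow boundaries are well separated (at positive distance). $f\in L^2(\Omega)$ and $g$ is measurable on $\Gamma_-$ with $\int_{\Gamma_-}|\boldsymbol\beta\cdot\mathbf n|g^2<\infty$. $\mathcal T$ is a regular (conforming, shape-regular) simplicial triangulation of $\Omega$; $\mathcal E_-$ is the set of mesh edges/faces on $\Gamma_-$, assumed to cover $\Gamma_-$ up to a null set; $h_F$ is the diameter of $F$ and $\alpha_F>0$ are mesh-size-independent constants. $\|v\|_{\omega,\Gamma_-}^2=\sum_{F\in\mathcal E_-}\int_F\frac{\omega}{|\boldsymbol\beta\cdot\mathbf n|}v^2$, with weights $\omega_1=1$ and $\omega_2|_F=\alpha_Fh_F$. $\Sigma=\{\boldsymbol\tau\in H(\mathrm{div};\Omega):\boldsymbol\tau\cdot\mathbf n\in L^2(\Gamma_-)\}$; $\|\cdot\|_0$ is the $L^2(\Omega)$ norm; $$\mathcal L_i(\boldsymbol\tau,v;f,g)=\|\boldsymbol\tau-\boldsymbol\beta v\|_0^2+\|\nabla\cdot\boldsymbol\tau+\gamma v-f\|_0^2+\|\boldsymbol\tau\cdot\mathbf n-(\boldsymbol\beta\cdot\mathbf n)g\|_{\omega_i,\Gamma_-}^2,$$ $$|\!|\!|(\boldsymbol\tau,v)|\!|\!|_B=\left(\|\boldsymbol\tau-\boldsymbol\beta v\|_0^2+\|\nabla\cdot\boldsymbol\tau+\gamma v\|_0^2+\|\boldsymbol\tau\cdot\mathbf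 n\|_{\omega,\Gamma_-}^2\right)^{1/2}.$$ For integer $k\ge0$, $P_k(K)$ denotes polynomials of degree $\le k$ on $K$; $RT_k=\{\boldsymbol\tau\in H(\mathrm{div};\Omega):\boldsymbol\tau|_K\in P_k(K)^d+\mathbf xP_k(K)\ \forall K\in\mathcal T\}$; $P_k=\{v\in L^2(\Omega):v|_K\in P_k(K)\ \forall K\in\mathcal T\}$. *)

(* Defs.v *)
From HB Require Import structures.
From mathcomp Require Import all_boot all_order all_algebra.
From mathcomp Require mpoly.
Import -(notations) mpoly.
From mathcomp Require Import all_classical all_reals all_analysis.
From mathcomp Require Import measurable_realfun.

Set Implicit Arguments.
Unset Strict Implicit.
Unset Printing Implicit Defensive.

Import Order.TTheory GRing.Theory Num.Theory.
Import numFieldNormedType.Exports.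

Local Open Scope classical_set_scope.
Local Open Scope ring_scope.

Section measurable_rV.
Context {R : realType} {n : nat}.

(* The coordinate cylinders generate the Borel sigma-algebra of R^n. *)
Definition coord_cylinder : set (set 'rV[R]_n) :=
  [set A | exists (i : 'I_n) (B : set (measurableTypeR R)),
    measurable B /\ A = (fun v : 'rV[R]_n => v 0 i) @^-1` B].

HB.instance Definition _ :=
  @isMeasurable.Build (sigma_display coord_cylinder) 'rV[R]_n
    <<s coord_cylinder >>
    (@sigma_algebra0 _ setT coord_cylinder)
    (@sigma_algebraC _ coord_cylinder)
    (@sigma_algebra_bigcup _ setT coord_cylinder).

Lemma measurable_coord (i : 'I_n) :
  measurable_fun [set: 'rV[R]_n]
    ((fun v => v 0 i) : 'rV[R]_n -> measurableTypeR R).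
Proof.
by move=> _ B mB; rewrite setTI; apply: sub_sigma_algebra; exists i, B.
Qed.

Lemma measurable_fun_rV d (T : measurableType d) (f : T -> 'rV[R]_n) :
  (forall i, measurable_fun setT ((fun t => f t 0 i) : T -> measurableTypeR R)) ->
  measurable_fun setT f.
Proof.
move=> mf; apply: (measurability coord_cylinder) => // _ [_ [i [B [mB ->]]] <-].
by rewrite -comp_preimage; exact: mf.
Qed.

End measurable_rV.


Lemma product_sigma_finite d1 d2 (T1 : measurableType d1)
    (T2 : measurableType d2) (R : realType)
    (m1 : {sigma_finite_measure set T1 -> \bar R})
    (m2 : {sigma_finite_measure set T2 -> \bar R}) :
  sigma_finite setT (m1 \x m2)%E.
Proof.
have /sigma_finiteP[F [TF ndF Foo]] := sigma_finiteT m1.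
have /sigma_finiteP[G [TG ndG Goo]] := sigma_finiteT m2.
exists (fun k => F k `*` G k) => [|k].
  rewrite -setXTT TF TG predeqE => -[x y]; split.
    move=> [/= [i _ Fix] [k _ Gky]]; exists (maxn i k) => //; split.
    - by move: x Fix; exact/subsetPset/ndF/leq_maxl.
    - by move: y Gky; exact/subsetPset/ndG/leq_maxr.
  by move=> [i _ []/= ? ?]; split; exists i.
have [? ?] := Foo k; have [? ?] := Goo k; split; first exact: measurableX.
by rewrite product_measure1E// lte_mul_pinfty// ge0_fin_numE.
Qed.

Section lebesgue_measure_rV.
Context {R : realType}.

Definition rv_cons {n} (p : measurableTypeR R * 'rV[R]_n) : 'rV[R]_n.+1 :=
  \row_i oapp (fun j => p.2 0 j) p.1 (unlift ord0 i).

Definition rv_uncons {n} (v : 'rV[R]_n.+1) : measurableTypeR R * 'rV[R]_n :=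
  (v 0 0, \row_j v 0 (lift ord0 j)).

Lemma rv_consK n : cancel (@rv_cons n) rv_uncons.
Proof.
move=> [x v]; rewrite /rv_uncons /rv_cons mxE unlift_none /=; congr pair.
by apply/rowP => j; rewrite !mxE liftK.
Qed.

Lemma measurable_rv_cons n : measurable_fun setT (@rv_cons n).
Proof.
apply: measurable_fun_rV => i; case: (unliftP ord0 i) => [j ->|->].
  apply: (eq_measurable_fun
    ((fun v : 'rV[R]_n => v 0 j : measurableTypeR R) \o snd)).
    by move=> p _ /=; rewrite mxE liftK.
  exact: measurableT_comp (measurable_coord j) measurable_snd.
apply: (eq_measurable_fun fst) => [p _ /=|]; first by rewrite mxE unlift_none.
exact: measurable_fst.
Qed.

Lemma measurable_rv_uncons n : measurable_fun setT (@rv_uncons n).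
Proof.
apply: measurable_fun_pair; first exact: measurable_coord.
apply: measurable_fun_rV => i.
apply: (eq_measurable_fun
  (fun v : 'rV[R]_n.+1 => v 0 (lift ord0 i) : measurableTypeR R)).
  by move=> v _; rewrite mxE.
exact: measurable_coord.
Qed.

Section step.
Variables (n : nat) (mu : {sigma_finite_measure set 'rV[R]_n -> \bar R}).

Definition lebesgue_step : set 'rV[R]_n.+1 -> \bar R :=
  pushforward (@lebesgue_measure R \x mu)%E rv_cons.

Let step0 : lebesgue_step set0 = 0%E.
Proof. by rewrite /lebesgue_step /pushforward preimage_set0 measure0. Qed.

Let step_ge0 A : (0 <= lebesgue_step A)%E.
Proof. by rewrite /lebesgue_step /pushforward; exact: measure_ge0. Qed.

Let step_sigma_additive : semi_sigma_additive lebesgue_step.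
Proof.
move=> F mF tF mUF; rewrite /lebesgue_step /pushforward preimage_bigcup.
apply: measure_semi_sigma_additive.
- by move=> k; rewrite -[X in measurable X]setTI; exact: measurable_rv_cons.
- apply/trivIsetP => /= i j _ _ ij; rewrite -preimage_setI.
  by move/trivIsetP : tF => /(_ _ _ _ _ ij) ->//; rewrite preimage_set0.
- rewrite -preimage_bigcup -[X in measurable X]setTI.
  exact: measurable_rv_cons.
Qed.

HB.instance Definition _ := isMeasure.Build _ _ _ lebesgue_step
  step0 step_ge0 step_sigma_additive.

Let step_sigma_finite : sigma_finite setT lebesgue_step.
Proof.
have [F TF Foo] : sigma_finite setT (@lebesgue_measure R \x mu)%E.
  exact: product_sigma_finite.
exists (fun k => rv_uncons @^-1` F k) => [|k].
  by rewrite -preimage_bigcup -TF preimage_setT.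
have [mF Fk] := Foo k; split.
  by rewrite -[X in measurable X]setTI; exact: measurable_rv_uncons.
rewrite /lebesgue_step /pushforward -comp_preimage.
rewrite (_ : rv_uncons \o rv_cons = id) ?preimage_id//.
by apply/funext => p /=; rewrite rv_consK.
Qed.

HB.instance Definition _ := Measure_isSigmaFinite.Build _ _ _ lebesgue_step
  step_sigma_finite.

End step.

Fixpoint lebesgue_rV n : {sigma_finite_measure set 'rV[R]_n -> \bar R} :=
  if n is n'.+1 then lebesgue_step (lebesgue_rV n') else dirac (0 : 'rV[R]_0).

End lebesgue_measure_rV.

Section euclidean_space.
Context {R : realType} {n : nat}.
Implicit Types (u v x y : 'rV[R]_n) (A V : set 'rV[R]_n).

Definition dotv u v : R := \sum_i u 0 i * v 0 i.

Definition enorm u : R := Num.sqrt (dotv u u).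

Definition diam A : R := sup [set enorm (x - y) | x in A & y in A].

Definition inball_diam A : R :=
  sup [set 2 * r | r in [set r : R |
    0 <= r /\ exists x, [set y | enorm (y - x) <= r] `<=` A]].

Definition convex_hull V : set 'rV[R]_n := smallest (@convex_set R 'rV[R]_n) V.

End euclidean_space.

Section differential_operators.
Context {R : realType} {n : nat}.
Local Notation V := 'rV[R]_n.+1.
Implicit Types (f phi : V -> R) (beta : V -> V) (Omega : set V).

Definition pderiv f (j : 'I_n.+1) (x : V) : R := 'D_('e_j) f x.

Definition grad f (x : V) : V := \row_j pderiv f j x.

Definition divergence beta (x : V) : R :=
  \sum_j pderiv (fun y => beta y 0 j) j x.

Fixpoint of_class_C k f : Prop :=
  continuous f /\
  if k is k'.+1 then
    forall j, (forall x, derivable f x 'e_j) /\ of_class_C k' (pderiv f j)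
  else True.

Definition smooth f := forall k, of_class_C k f.

Definition test_function Omega phi :=
  smooth phi /\ exists K : set V,
    [/\ compact K, K `<=` Omega & forall x, ~ K x -> phi x = 0].

(* Membership in [C^1(closure Omega)]^d: the field and its first partial
   derivatives in Omega extend continuously up to the boundary. *)
Definition C1_closure Omega beta :=
  {within closure Omega, continuous beta} /\
  forall i j : 'I_n.+1,
    (forall x, Omega x -> derivable (fun y => beta y 0 i) x 'e_j) /\
    exists D : V -> R, {within closure Omega, continuous D} /\
      forall x, Omega x -> pderiv (fun y => beta y 0 i) j x = D x.

End differential_operators.

Section domain.
Context {R : realType} {n : nat}.
Local Notation V := 'rV[R]_n.+1.
Implicit Types (Omega : set V) (beta : V -> V) (x y nu : V).

Definition bdry Omega : set V := closure Omega `\` interior Omega.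

Definition polyhedral Omega :=
  exists (m : nat) (P : 'I_m -> set V), (forall i, finite_set (P i)) /\
    closure Omega = \bigcup_i convex_hull (P i).

(* Locally, in the orthonormal coordinates y *m U, the domain is the strict
   epigraph (in the first coordinate) of a Lipschitz function of the others. *)
Definition lipschitz_boundary Omega :=
  forall x, bdry Omega x ->
    exists (r L : R) (U : 'M[R]_n.+1) (psi : 'rV[R]_n -> R),
      [/\ 0 < r, U *m U^T = 1%:M,
          forall s t, `|psi s - psi t| <= L * enorm (s - t) &
          forall y, enorm (y - x) < r ->
            Omega y <->
            psi (\row_j (y *m U) 0 (lift ord0 j)) < (y *m U) 0 ord0].

Definition bounded_polyhedral_lipschitz_domain Omega :=
  [/\ open Omega, connected Omega, Omega !=set0, bounded_set Omega &
      polyhedral Omega /\ lipschitz_boundary Omega].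

(* The boundary of a polyhedral domain is flat outside of a set of dimension
   d - 2, and this characterizes the outward normal at its flat points. *)
Definition is_outward_normal Omega x nu :=
  enorm nu = 1 /\
  exists2 r : R, 0 < r &
    forall y, enorm (y - x) < r -> (Omega y <-> dotv (y - x) nu < 0).

(* 0 on the non-flat part of the boundary, which thus lies neither in the
   inflow nor in the outflow boundary. *)
Definition normal Omega x : V := xget 0 (is_outward_normal Omega x).

Definition betan Omega beta x : R := dotv (beta x) (normal Omega x).

Definition inflow Omega beta : set V :=
  [set x | bdry Omega x /\ betan Omega beta x < 0].

Definition outflow Omega beta : set V :=
  [set x | bdry Omega x /\ 0 < betan Omega beta x].

End domain.

Section transport_assumptions.
Context {R : realType} {n : nat}.
Local Notation V := 'rV[R]_n.+1.
Implicit Types (Omega : set V) (beta : V -> V) (gamma : V -> R).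

Definition Linfty Omega gamma :=
  measurable_fun Omega gamma /\
  exists M : R, {ae lebesgue_rV n.+1, forall x, Omega x -> `|gamma x| <= M}.

Definition streamline Omega beta (T : R) (X : R -> V) :=
  [/\ 0 < T, {within `[0, T], continuous X},
      forall t, t \in `[0, T] -> closure Omega (X t) &
      forall t : R, t \in `]0, T[ -> is_derive t 1 X (beta (X t))].

(* The curve has speed |X'| = |beta o X|. *)
Definition finite_length beta (T : R) (X : R -> V) :=
  (\int[lebesgue_measure]_(t in `[0%R, T]) (enorm (beta (X t)))%:E < +oo)%E.

(* Streamlines may enter or leave the domain through the edges of the
   polyhedron, where there is no normal, hence the closures. *)
Definition streamlines_connect Omega beta :=
  (forall p, inflow Omega beta p ->
    exists (T : R) (X : R -> V),
      [/\ streamline Omega beta T X, finite_length beta T X, X 0 = p &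
          closure (outflow Omega beta) (X T)]) /\
  (forall x, Omega x ->
    exists (T : R) (X : R -> V),
      [/\ streamline Omega beta T X, finite_length beta T X,
          closure (inflow Omega beta) (X 0),
          closure (outflow Omega beta) (X T) &
          exists2 t, t \in `]0, T[ & X t = x]).

(* Phi is a C^1 change of coordinates with bounded Jacobian determinant; along
   a streamline issued from the inflow boundary only the r-th new coordinate
   varies. *)
Definition straightens Omega beta (Phi : V -> V) (r : 'I_n.+1) :=
  [/\ {in Omega &, injective Phi},
      forall x, Omega x ->
        differentiable Phi x /\ {for x, continuous (jacobian Phi)},
      exists M : R, forall x, Omega x -> 0 < `|\det (jacobian Phi x)| <= M &
      forall (T : R) (X : R -> V),
        streamline Omega beta T X -> inflow Omega beta (X 0) ->
        forall s t, s \in `[0, T] -> t \in `[0, T] ->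
        Omega (X s) -> Omega (X t) ->
        forall j, j != r -> Phi (X s) 0 j = Phi (X t) 0 j].

Definition assumption_i Omega beta :=
  [/\ exists C : R, forall x, Omega x -> 0 < enorm (beta x) < C,
      exists Phi r, straightens Omega beta Phi r &
      streamlines_connect Omega beta].

Definition assumption_ii Omega beta gamma :=
  (exists2 gamma0 : R, 0 < gamma0 &
    {ae lebesgue_rV n.+1, forall x, Omega x ->
      gamma0 <= gamma x + 2^-1 * divergence beta x}) /\
  (exists2 delta : R, 0 < delta &
    forall x y, inflow Omega beta x -> outflow Omega beta y ->
      delta <= enorm (x - y)).

End transport_assumptions.

Section face_measure.
Context {R : realType} {n : nat}.
Variables (p : 'I_n.+2 -> 'rV[R]_n.+1) (i : 'I_n.+2).

(* Edge vectors, from the first vertex, of the face opposite to the vertex i *)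
Definition face_edges : 'M[R]_(n, n.+1) :=
  \matrix_(j < n) (p (lift i (lift ord0 j)) - p (lift i ord0)).

Definition face_param (t : 'rV[R]_n) : 'rV[R]_n.+1 :=
  p (lift i ord0) + t *m face_edges.

Definition unit_simplex : set 'rV[R]_n :=
  [set t | (forall j, 0 <= t 0 j) /\ \sum_j t 0 j <= 1].

(* Gram determinant: the area element of the affine parametrization *)
Definition area_factor : R := Num.sqrt (\det (face_edges *m face_edges^T)).

(* The (d-1)-dimensional surface measure carried by the face; the boundary
   facets of a triangulation tile the boundary of the domain up to null sets,
   hence boundary integrals below are sums over facets. *)
Definition face_measure (A : set 'rV[R]_n.+1) : \bar R :=
  (area_factor%:E * lebesgue_rV n (unit_simplex `&` face_param @^-1` A))%E.

Lemma measurable_face_param : measurable_fun setT face_param.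
Proof.
apply: measurable_fun_rV => k.
apply: (eq_measurable_fun (fun t : 'rV[R]_n =>
  p (lift i ord0) 0 k + \sum_(j <- index_enum 'I_n) t 0 j * face_edges j k
    : measurableTypeR R)).
  by move=> t _; rewrite /face_param [in RHS]mxE [in RHS]mxE.
apply: measurable_funD; first exact: measurable_cst.
apply: measurable_sum => j; apply: measurable_funM; last exact: measurable_cst.
exact: measurable_coord.
Qed.

Lemma measurable_unit_simplex : measurable unit_simplex.
Proof.
rewrite (_ : unit_simplex =
  (\bigcap_(j in [set: 'I_n]) ((fun t : 'rV[R]_n => t 0 j) @^-1` `[0, +oo[)) `&`
  ((fun t : 'rV[R]_n => \sum_(j <- index_enum 'I_n) t 0 j) @^-1` `]-oo, 1])).
  apply: measurableI.
    apply: fin_bigcap_measurable => // j _; rewrite -[X in measurable X]setTI.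
    exact: measurable_coord.
  rewrite -[X in measurable X]setTI.
  apply: (@measurable_sum _ _ R) => // j; exact: measurable_coord.
apply/seteqP; split => t /=.
  by move=> [t0 t1]; split=> [j _ /=|]; rewrite in_itv/= ?andbT.
move=> [t0]; rewrite in_itv/= => t1; split=> // j.
by have := t0 j Logic.I; rewrite /= in_itv/= andbT.
Qed.

Let face_measure0 : face_measure set0 = 0%E.
Proof. by rewrite /face_measure preimage_set0 setI0 measure0 mule0. Qed.

Let face_measure_ge0 A : (0 <= face_measure A)%E.
Proof. by rewrite mule_ge0 ?measure_ge0// lee_fin sqrtr_ge0. Qed.

Let face_measure_sigma_additive : semi_sigma_additive face_measure.
Proof.
have E (A : set 'rV[R]_n.+1) : face_measure A =
    mscale (NngNum (sqrtr_ge0 (\det (face_edges *m face_edges^T))))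
      (mrestr (lebesgue_rV n) measurable_unit_simplex) (face_param @^-1` A).
  by rewrite /face_measure /mscale /mrestr setIC.
have mP A : measurable A -> measurable (face_param @^-1` A).
  by move=> mA; rewrite -[X in measurable X]setTI; exact: measurable_face_param.
move=> F mF tF mUF; rewrite E preimage_bigcup.
under eq_fun do under eq_bigr do rewrite E.
apply: measure_semi_sigma_additive.
- by move=> k; exact: mP.
- apply/trivIsetP => /= j k _ _ jk; rewrite -preimage_setI.
  by move/trivIsetP : tF => /(_ _ _ _ _ jk) ->//; rewrite preimage_set0.
- by rewrite -preimage_bigcup; exact: mP.
Qed.

HB.instance Definition _ := isMeasure.Build _ _ _ face_measure
  face_measure0 face_measure_ge0 face_measure_sigma_additive.

End face_measure.

Section triangulation.
Context {R : realType} {n : nat}.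
Local Notation V := 'rV[R]_n.+1.

(* A finite family of simplices, each given by its vertices; a facet is a cell
   together with the index of the opposite vertex, so that an interior facet
   occurs twice but a boundary facet only once. *)
Record mesh := Mesh {
  ncells : nat;
  vertex : 'I_ncells -> 'I_n.+2 -> V }.

Implicit Types (T : mesh) (Omega : set V) (beta : V -> V).

Definition facet T : finType := ('I_(ncells T) * 'I_n.+2)%type.

Definition cell_set T (K : 'I_(ncells T)) : set V :=
  convex_hull (range (vertex K)).

Definition facet_set T (F : facet T) : set V :=
  convex_hull (range (fun j => vertex F.1 (lift F.2 j))).

Definition surf T (F : facet T) : {measure set V -> \bar R} :=
  face_measure (vertex F.1) F.2.

Definition nondegenerate (p : 'I_n.+2 -> V) :=
  \det (\matrix_(j < n.+1) (p (lift ord0 j) - p ord0)) != 0.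

Definition conforming T :=
  forall K K' : 'I_(ncells T), K != K' ->
    range (vertex K) <> range (vertex K') /\
    cell_set K `&` cell_set K' =
      convex_hull (range (vertex K) `&` range (vertex K')).

Definition shape_regular T (kappa : R) :=
  forall K : 'I_(ncells T),
    diam (cell_set K) <= kappa * inball_diam (cell_set K).

Definition regular_triangulation Omega T (kappa : R) :=
  [/\ forall K : 'I_(ncells T), nondegenerate (vertex K),
      closure Omega = \bigcup_(K in [set: 'I_(ncells T)]) cell_set K,
      conforming T & shape_regular T kappa].

Definition boundary_facet Omega T (F : facet T) :=
  facet_set F `<=` bdry Omega.

(* The elements of E_-. Almost everywhere because the edges of the polyhedron,
   where there is no normal, are not in the inflow boundary. *)
Definition inflow_facet Omega beta T (F : facet T) : bool :=
  `[< {ae surf F, forall x, inflow Omega beta x} >].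

Definition inflow_covered Omega beta T :=
  forall F : facet T, boundary_facet Omega F ->
    {ae surf F, forall x, inflow Omega beta x ->
      exists2 F' : facet T, inflow_facet Omega beta F' & facet_set F' x}.

(* The weights omega_1 and omega_2, as functions of the facet *)
Definition weight T (alpha : facet T -> R) (i : nat) (F : facet T) : R :=
  if i == 1%N then 1 else alpha F * diam (facet_set F).

End triangulation.
Arguments mesh : clear implicits.

Section least_squares.
Context {R : realType} {n : nat}.
Local Notation V := 'rV[R]_n.+1.
Local Notation mu := (lebesgue_rV n.+1).
Variables (Omega : set V) (beta : V -> V) (gamma : V -> R) (T : mesh R n).
Implicit Types (tau : V -> V) (v w q f g : V -> R) (omega : facet T -> R).

Local Notation Gamma := (inflow Omega beta).
Local Notation bn := (betan Omega beta).

Definition nrm2 v : \bar R := (\int[mu]_(x in Omega) (v x ^+ 2)%:E)%E.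

Definition vnrm2 tau : \bar R :=
  (\int[mu]_(x in Omega) (dotv (tau x) (tau x))%:E)%E.

Definition L2 v := measurable_fun Omega v /\ (nrm2 v < +oo)%E.

Definition L2_vec tau := forall j, L2 (fun x => tau x 0 j).

Definition is_weak_div tau w :=
  L2 w /\ forall phi, test_function Omega phi ->
    \int[mu]_(x in Omega) dotv (tau x) (grad phi x) =
    - \int[mu]_(x in Omega) (w x * phi x).

Definition Hdiv tau := L2_vec tau /\ exists w, is_weak_div tau w.

(* A representative of the weak divergence, unique up to a null set *)
Definition wdiv tau : V -> R := xget (cst 0) (is_weak_div tau).

Definition wnrm2 omega q : \bar R :=
  (\sum_(F : facet T | inflow_facet Omega beta F)
    \int[surf F]_(x in Gamma) (omega F / `|bn x| * q x ^+ 2)%:E)%E.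

Definition L2_inflow q :=
  measurable_fun Gamma q /\
  (\sum_(F : facet T | inflow_facet Omega beta F)
    \int[surf F]_(x in Gamma) (q x ^+ 2)%:E < +oo)%E.

(* Green's formula against the functions with zero trace on the rest of the
   boundary: q in L^2(Gamma_-) is the normal trace of tau on Gamma_-. *)
Definition is_normal_trace tau q :=
  L2_inflow q /\ forall phi, smooth phi ->
    (forall F : facet T, boundary_facet Omega F ->
      {ae surf F, forall x, ~ Gamma x -> phi x = 0}) ->
    \int[mu]_(x in Omega) (dotv (tau x) (grad phi x) + wdiv tau x * phi x) =
    \sum_(F : facet T | inflow_facet Omega beta F)
      \int[surf F]_(x in Gamma) (q x * phi x).

Definition has_normal_trace tau := exists q, is_normal_trace tau q.

(* A representative of the normal trace, unique up to a null set *)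
Definition ntrace tau : V -> R := xget (cst 0) (is_normal_trace tau).

Definition Sigma tau := Hdiv tau /\ has_normal_trace tau.

(* || tau . n - h ||^2_{omega, Gamma_-}, infinite if tau . n is not in
   L^2(Gamma_-) *)
Definition trace_nrm2 omega tau h : \bar R :=
  if `[< has_normal_trace tau >] then wnrm2 omega (fun x => ntrace tau x - h x)
  else +oo%E.

Definition LS omega f g (tv : (V -> V) * (V -> R)) : \bar R :=
  (vnrm2 (fun x => tv.1 x - tv.2 x *: beta x)%R +
   nrm2 (fun x => wdiv tv.1 x + gamma x * tv.2 x - f x)%R +
   trace_nrm2 omega tv.1 (fun x => bn x * g x)%R)%E.

Definition normB omega tau v : \bar R :=
  (vnrm2 (fun x => tau x - v x *: beta x)%R +
   nrm2 (fun x => wdiv tau x + gamma x * v x)%R +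
   trace_nrm2 omega tau (cst 0%R))%E `^ 2^-1.

Definition polynomial_le (k : nat) (p : mpoly.mpoly n.+1 R) :=
  (mpoly.msize p <= k.+1)%N.

Definition RT (k : nat) tau :=
  Hdiv tau /\ forall K : 'I_(ncells T),
    exists (p : 'I_n.+1 -> mpoly.mpoly n.+1 R) (q : mpoly.mpoly n.+1 R),
      [/\ forall j, polynomial_le k (p j), polynomial_le k q &
          {ae mu, forall x, cell_set K x ->
            tau x = \row_j mpoly.meval (x 0) (p j) +
                    mpoly.meval (x 0) q *: x}].

Definition Pk (k : nat) v :=
  L2 v /\ forall K : 'I_(ncells T),
    exists2 p : mpoly.mpoly n.+1 R, polynomial_le k p &
      {ae mu, forall x, cell_set K x -> v x = mpoly.meval (x 0) p}.

End least_squares.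

Definition minimizer (R : realType) (X : Type) (S : set X) (J : X -> \bar R)
    (w : X) :=
  S w /\ forall w', S w' -> (J w <= J w')%E.

(* Main.v *)
(* The solution and the discrete solution are both least-squares minimizers, so
   their residuals are orthogonal to every discrete direction and Pythagoras'
   theorem gives the estimate. A discrete flux without a normal trace in
   L^2(Gamma_-) has infinite distance to the solution.

   The residual depends linearly on the unknowns only because weak divergences
   and normal traces are unique almost everywhere. With F(t) = exp(- 1 / t) for
   0 < t and F(t) = 0 otherwise, the smooth functions
   prod_i F(m (x_i - a_i)) F(m (b_i - x_i)) converge, as m grows, to the
   indicator of the box (a, b), and boxes determine an integrable function.
   They are admissible for traces because Gamma_- is relatively open in the
   boundary: the outward normal is locally constant at flat boundary points. *)

Require Import Defs.
From mathcomp Require Import all_boot all_order all_algebra.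
From mathcomp Require mpoly.
Import -(notations) mpoly.
From mathcomp Require Import all_classical all_reals all_analysis.
From mathcomp Require Import measurable_realfun.
From mathcomp Require Import ring lra.

Set Implicit Arguments.
Unset Strict Implicit.
Unset Printing Implicit Defensive.

Import Order.TTheory GRing.Theory Num.Theory.
Import numFieldNormedType.Exports.

Local Open Scope classical_set_scope.
Local Open Scope ring_scope.

(** * Smooth bump functions *)

(** [wdiv] and [ntrace] are chosen separately for each flux, so linear identities between residuals
    hold only off null sets. A normal trace is moreover defined through the chosen divergence, so
    that uniqueness of the divergence has to precede linearity of the trace. Testing a trace yields
    one equation for the sum over all inflow facets, each with its own measure; the fundamental
    lemma is therefore proved for one function and a finite family of measures, and the sign of the
    function separates the measures. The flux, balance and inflow residuals are placed in one finite
    family of weighted L^2 spaces, where the functional is a single squared norm and its increment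
    along a direction is a quadratic polynomial in one real parameter. Neither residual has to
    vanish: the data cancel in the difference of the two. The constant [c] bounds the weight
    [omega F / |bn|], so that square-integrable traces have a finite weighted norm. RT_k carries no
    condition on traces; the discrete minimizer nevertheless has one, since its functional does not
    exceed the finite value at zero. *)

Section flat.
Context {R : realType}.
Implicit Types (p : {poly R}) (x : R).

(* The polynomial factor makes this family stable under differentiation. *)
Definition flat p x : R := if 0 < x then p.[x^-1] * expR (- x^-1) else 0.

(** By the chain rule, p(1/x) exp(-1/x) has the derivative (p - p')(1/x) x^-2 exp(-1/x), which is
    again of the form [flat]. *)
Definition flat_deriv p : {poly R} := 'X^2 * (p - p^`()).

(** With y = 1/x, exp(y) is at least y^(n+1) / (n+1)!; the one power in excess of [n] leaves the
    factor [x]. *)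
Lemma exprn_expRN_le n x : 0 < x -> x^-1 ^+ n * expR (- x^-1) <= n.+1`!%:R * x.
Proof.
move=> x0; have y0 : 0 < x^-1 by rewrite invr_gt0.
have f0 : 0 < n.+1`!%:R :> R by rewrite ltr0n fact_gt0.
have := expR_ge1Dxn n (ltW y0) => h.
have {h} : x^-1 ^+ n.+1 / n.+1`!%:R <= expR x^-1.
  by apply: le_trans h; rewrite lerDr.
rewrite ler_pdivrMr// => h.
rewrite expRN ler_pdivrMr ?expR_gt0//.
rewrite (_ : _ ^+ n = x^-1 ^+ n.+1 * x); last first.
  by rewrite exprSr -mulrA mulVf ?mulr1// gt_eqF.
by rewrite mulrAC ler_pM2r// mulrC.
Qed.

Lemma flat_le p : exists C, forall x, 0 < x -> `|flat p x| <= C * x.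
Proof.
exists (\sum_(i < size p) `|p`_i| * i.+1`!%:R) => x x0.
rewrite /flat x0 horner_coef mulr_suml mulr_suml.
apply: le_trans (ler_norm_sum _ _ _) _; apply: ler_sum => i _.
rewrite -mulrA normrM -mulrA ler_wpM2l// ger0_norm.
  exact: exprn_expRN_le.
by rewrite mulr_ge0 ?expR_ge0// exprn_ge0// invr_ge0 ltW.
Qed.

(** The linear bound for ['X * p] is a quadratic one for [p], since the extra ['X] contributes a
    factor 1/x. A quadratic bound forces the difference quotients at the origin to tend to 0. *)
Lemma flat_le_sqr p : exists2 C, 0 <= C & forall x, `|flat p x| <= C * x ^+ 2.
Proof.
have [C hC] := flat_le ('X * p).
have C0 : 0 <= C by have := hC 1 ltr01; rewrite mulr1; exact: le_trans.
exists C => // x; have [x0|x0] := ltP 0 x; last first.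
  by rewrite /flat ltNge x0/= normr0 mulr_ge0// sqr_ge0.
have := hC x x0; rewrite /flat x0 !hornerE -mulrA normrM ger0_norm; last first.
  by rewrite invr_ge0 ltW.
by rewrite mulrC ler_pdivrMr// -mulrA -expr2.
Qed.

Lemma is_derive_flat p x : is_derive x 1 (flat p) (flat (flat_deriv p) x).
Proof.
have [x0|x0|<-] := ltgtP 0 x.
- have xn0 : x != 0 by rewrite gt_eqF.
  apply: (@near_eq_is_derive R R^o R^o (fun y : R => p.[y^-1] * expR (- y^-1))).
    have : \forall y \near x, 0 < y by exact: lt_nbhsr.
    by apply: filterS => y y0; rewrite /flat y0.
  have dV : is_derive x (1 : R) (fun y : R => y^-1) (- x ^- 2).
    apply: DeriveDef; first by apply: derivableV => //; exact: derivable_id.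
    by rewrite deriveV// ?derive_id ?[_ *: 1]mulr1//; exact: derivable_id.
  have dp : is_derive x (1 : R) (fun y : R => p.[y^-1]) (p^`().[x^-1] * - x ^- 2).
    have hp : is_derive x^-1 (1 : R) (horner p) p^`().[x^-1].
      apply: DeriveDef; first exact: derivable_horner.
      by rewrite -derive1E -derivE.
    exact: (@is_derive1_comp _ (horner p) (fun y : R => y^-1)).
  have de : is_derive x (1 : R) (fun y : R => expR (- y^-1)) (expR (- x^-1) * x ^- 2).
    have dN : is_derive x (1 : R) (fun y : R => - y^-1) (x ^- 2).
      by rewrite -[x ^- 2]opprK; exact: is_deriveN.
    have := is_derive_expR (- x^-1) => dE.
    exact: (@is_derive1_comp _ expR (fun y : R => - y^-1)).
  apply: is_derive_eq.
  rewrite /flat x0 /flat_deriv !hornerE /GRing.scale/= exprVn.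
  by ring.
- apply: (@near_eq_is_derive R R^o R^o (cst 0)).
    have : \forall y \near x, y < 0 by exact: lt_nbhsl.
    by apply: filterS => y y0; rewrite /flat ltNge (ltW y0).
  by apply: is_derive_eq; rewrite /flat ltNge (ltW x0).
(* At the origin the difference quotient is squeezed between 0 and [C * |h|]. *)
have [C C0 hC] := flat_le_sqr p.
have f0 q : flat q 0 = 0 by rewrite /flat ltxx.
rewrite f0.
suff h : (fun h => h^-1 *: ((flat p \o shift 0) (h *: 1) - flat p 0)) @ 0^' --> (0 : R).
  by apply: DeriveDef; [apply/cvg_ex; exists 0|apply: cvg_lim].
apply: norm_cvg0.
have : (fun h : R => C * `|h|) @ 0^' --> (0 : R).
  rewrite -[X in _ --> X](mulr0 C); apply: cvgMr.
  apply: cvg_within_filter.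
  have := @norm_continuous _ R^o 0; rewrite /continuous_at (@normr0 R R); exact.
apply: (@squeeze_cvgr _ _ _ _ (cst 0)); last exact: cvg_cst.
near=> h; rewrite normr_ge0/= f0 subr0 addr0 [_%:A]mulr1.
have h0 : h != 0 by near: h; exact: nbhs_dnbhs_neq.
rewrite normrZ normfV ler_pdivrMl ?normr_gt0//.
by rewrite mulrCA -expr2 real_normK ?num_real.
Unshelve. all: by end_near. Qed.

Lemma flat1_bounds x : 0 <= flat 1 x <= 1.
Proof.
rewrite /flat; case: ifPn => x0; last by rewrite lexx ler01.
by rewrite hornerC mul1r expR_ge0 expR_le1 oppr_le0 invr_ge0 ltW.
Qed.

Lemma flat1_cvg x : flat 1 (m.+1%:R * x) @[m --> \oo] --> ((0 < x)%R%:R : R).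
Proof.
rewrite /flat; have [x0|x0] := ltP 0 x; last first.
  rewrite (_ : (fun _ => _) = cst 0); first exact: cvg_cst.
  by apply/funext => m; rewrite ltNge mulr_ge0_le0.
rewrite (_ : (fun _ => _) = (fun m => expR (- (m.+1%:R^-1 * x^-1)))).
  rewrite [X in _ --> X](_ : _ = expR (- (0 * x^-1))); last first.
    by rewrite mul0r oppr0 expR0.
  apply: continuous_cvg; first exact: continuous_expR.
  by apply: cvgN; apply: cvgMl; exact: cvg_harmonic.
by apply/funext => m; rewrite mulr_gt0// hornerC mul1r invfM.
Qed.

End flat.

(** * Closure properties of the class C^k *)

Section of_class_C.
Context {R : realType} {n : nat}.
Local Notation V := 'rV[R]_n.+1.
Implicit Types f g : V -> R.

Lemma continuous_rVD f g : continuous f -> continuous g ->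
  continuous (fun x => f x + g x).
Proof. by move=> cf cg x; exact: (@continuousD R R^o V f g x (cf x) (cg x)). Qed.

Lemma continuous_rVM f g : continuous f -> continuous g ->
  continuous (fun x => f x * g x).
Proof. by move=> cf cg x; exact: (@continuousM R V f g x (cf x) (cg x)). Qed.

Lemma continuous_rV_cst (c : R) : continuous (fun _ : V => c).
Proof. by move=> x; exact: (@cst_continuous V R). Qed.

(** Needed for products: Leibniz's rule multiplies a derivative by an undifferentiated factor, whose
    class has to be lowered by one. *)
Lemma of_class_CS k f : of_class_C k.+1 f -> of_class_C k f.
Proof.
elim: k f => [|k ih] f /=; first by case.
by move=> [cf hf]; split => // j; have [df pf] := hf j; split=> //; exact: ih.
Qed.

Lemma of_class_C_continuous k f : of_class_C k f -> continuous f.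
Proof. by case: k => [|k] []. Qed.

Lemma of_class_CD k f g : of_class_C k f -> of_class_C k g ->
  of_class_C k (fun x => f x + g x).
Proof.
elim: k f g => [|k ih] f g [cf hf] [cg hg].
  by split=> //; exact: continuous_rVD.
split=> [|j]; first exact: continuous_rVD.
have [df pf] := hf j; have [dg pg] := hg j; split=> [x|].
  by apply: derivableD; [exact: df|exact: dg].
rewrite (_ : pderiv _ j = (fun x => pderiv f j x + pderiv g j x)); first exact: ih.
by apply/funext => x; rewrite /pderiv deriveD; [|exact: df|exact: dg].
Qed.

Lemma of_class_CM k f g : of_class_C k f -> of_class_C k g ->
  of_class_C k (fun x => f x * g x).
Proof.
elim: k f g => [|k ih] f g.
  by move=> [cf _] [cg _]; split=> //; exact: continuous_rVM.
move=> hf hg; have [cf pf] := hf; have [cg pg] := hg.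
split=> [|j]; first exact: continuous_rVM.
have [df p'f] := pf j; have [dg p'g] := pg j; split=> [x|].
  by apply: derivableM; [exact: df|exact: dg].
rewrite (_ : pderiv _ j = (fun x => f x * pderiv g j x + g x * pderiv f j x)).
  by apply: of_class_CD; apply: ih => //; exact: of_class_CS.
by apply/funext => x; rewrite /pderiv deriveM; [|exact: df|exact: dg].
Qed.

Lemma of_class_C_cst k c : of_class_C k (fun _ : V => c).
Proof.
elim: k c => [|k ih] c; first by split=> //; exact: continuous_rV_cst.
split=> [|j]; first exact: continuous_rV_cst.
split=> [x|]; first exact: derivable_cst.
rewrite (_ : pderiv _ j = (fun=> 0)); first exact: ih.
by apply/funext => x; rewrite /pderiv derive_cst.
Qed.

Lemma of_class_C_prod k (I : Type) (s : seq I) (F : I -> V -> R) :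
  (forall i, of_class_C k (F i)) ->
  of_class_C k (fun x => \prod_(i <- s) F i x).
Proof.
move=> hF; elim: s => [|i s ih].
  under eq_fun do rewrite big_nil; exact: of_class_C_cst.
by under eq_fun do rewrite big_cons; apply: of_class_CM.
Qed.

Lemma is_derive_flat_coord p (a c : R) (i j : 'I_n.+1) (x : V) :
  is_derive x 'e_j (fun y : V => flat p (a * y 0 i + c))
    ((a * (i == j)%:R) * flat (flat_deriv p) (a * x 0 i + c)).
Proof.
(* The restriction to the line through [x] in the direction ['e_j], where the chain rule in one
   variable applies. *)
pose G t := flat p (a * (x 0 i + t * (i == j)%:R) + c).
have dG : is_derive (0 : R) (1 : R) G
    ((a * (i == j)%:R) * flat (flat_deriv p) (a * x 0 i + c)).
  have h : is_derive (0 : R) (1 : R)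
      (fun t : R => a * (x 0 i + t * (i == j)%:R) + c) (a * (i == j)%:R).
    rewrite (_ : (fun _ => _) = (fun t => (a * (i == j)%:R) *: t + (a * x 0 i + c))).
      by apply: is_derive_eq; rewrite addr0 [_ *: 1]mulr1.
    by apply/funext => t; rewrite /GRing.scale/=; ring.
  rewrite mulrC.
  have := @is_derive1_comp _ (flat p) _ 0 _ _ _ h.
  by rewrite mul0r addr0; apply; exact: is_derive_flat.
have E : (fun h : R => flat p (a * (h *: 'e_j + x : V) 0 i + c)) = G.
  apply/funext => h; rewrite /G !mxE eqxx /= eq_sym addrC.
  by rewrite /GRing.scale/=.
apply: DeriveDef.
  by apply/derivable1P; rewrite E; case: dG.
rewrite /derive; case: dG => _ <-; rewrite /derive.
rewrite [X in lim (X @ _)](_ : _ = fun h => h^-1 *: ((G \o shift 0) h%:A - G 0))//.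
apply/funext => h /=; rewrite addr0 [_%:A]mulr1.
by rewrite -E /= scale0r add0r.
Qed.

(** Induction on [k] for all [p] at once: a partial derivative is a constant times the same kind of
    function, with [flat_deriv p] in place of [p]. *)
Lemma of_class_C_flat_coord k p (a c : R) (i : 'I_n.+1) :
  of_class_C k (fun y : V => flat p (a * y 0 i + c)).
Proof.
have cl : continuous (fun y : V => a * y 0 i + c).
  apply: continuous_rVD; last exact: continuous_rV_cst.
  by apply: continuous_rVM; [exact: continuous_rV_cst|move=> x; exact: coord_continuous].
have hc q : continuous (fun y : V => flat q (a * y 0 i + c)).
  move=> x; apply: (@continuous_comp _ _ _ (fun y : V => a * y 0 i + c) (flat q)).
    exact: cl.
  apply: differentiable_continuous; apply/derivable1_diffP.
  by have [] := is_derive_flat q (a * x 0 i + c).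
elim: k p => [|k ih] p; first by split.
split=> // j; split=> [x|]; first by have [] := is_derive_flat_coord p a c i j x.
rewrite (_ : pderiv _ j = (fun y : V =>
    (a * (i == j)%:R) * flat (flat_deriv p) (a * y 0 i + c))).
  by apply: of_class_CM; [exact: of_class_C_cst|exact: ih].
by apply/funext => x; rewrite /pderiv; have [_ ->] := is_derive_flat_coord p a c i j x.
Qed.

End of_class_C.

(** * Smooth approximations of the indicator of a box *)

Section box_bump.
Context {R : realType} {n : nat}.
Local Notation V := 'rV[R]_n.+1.
Implicit Types (a b x : V) (m : nat).

Definition obox a b : set V := [set x | forall i, a 0 i < x 0 i < b 0 i].

Definition cbox a b : set V := [set x | forall i, a 0 i <= x 0 i <= b 0 i].

Definition box_bump m a b x : R :=
  \prod_(i < n.+1) (flat 1 (m.+1%:R * (x 0 i - a 0 i)) *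
                    flat 1 (m.+1%:R * (b 0 i - x 0 i))).

Lemma smooth_box_bump m a b : smooth (box_bump m a b).
Proof.
move=> k; apply: of_class_C_prod => i; apply: of_class_CM.
  rewrite (_ : (fun _ => _) = (fun y : V =>
    flat 1 (m.+1%:R * y 0 i + (- (m.+1%:R * a 0 i))))).
    exact: of_class_C_flat_coord.
  by apply/funext => y; rewrite mulrBr.
rewrite (_ : (fun _ => _) = (fun y : V =>
  flat 1 (- m.+1%:R * y 0 i + m.+1%:R * b 0 i))).
  exact: of_class_C_flat_coord.
by apply/funext => y; rewrite mulrBr addrC mulNr.
Qed.

Lemma box_bump_bounds m a b x : 0 <= box_bump m a b x <= 1.
Proof.
apply/andP; split.
  apply: prodr_ge0 => i _; apply: mulr_ge0.
    by have /andP[] := flat1_bounds (m.+1%:R * (x 0 i - a 0 i)).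
  by have /andP[] := flat1_bounds (m.+1%:R * (b 0 i - x 0 i)).
apply: Num.Theory.prodr_ile1 => i _.
have /andP[h1 h2] := flat1_bounds (m.+1%:R * (x 0 i - a 0 i)).
have /andP[h3 h4] := flat1_bounds (m.+1%:R * (b 0 i - x 0 i)).
by rewrite mulr_ge0//= mulr_ile1.
Qed.

Lemma cvg_box_bump a b x :
  box_bump m a b x @[m --> \oo] --> (\1_(obox a b) x : R).
Proof.
have -> : \1_(obox a b) x =
    \prod_(i < n.+1) ((0 < x 0 i - a 0 i)%R%:R * (0 < b 0 i - x 0 i)%R%:R : R).
  rewrite indicE; have [xab|xab] := boolP (x \in obox a b).
    rewrite big1// => i _; move: xab; rewrite inE => /(_ i) /andP[h1 h2].
    by rewrite !subr_gt0 h1 h2 mulr1.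
  apply/esym/eqP; rewrite prodf_seq_eq0; apply/hasP.
  have [i hi] : exists i, ~ (a 0 i < x 0 i < b 0 i).
    by apply/existsNP => h; move: xab; rewrite notin_setE; exact.
  exists i; rewrite ?mem_index_enum//= !subr_gt0.
  move/negP: hi; rewrite negb_and => /orP[|] /negbTE ->; first by rewrite mul0r.
  by rewrite mulr0.
rewrite /box_bump; elim: (index_enum _) => [|i s ih].
  under eq_fun do rewrite big_nil; rewrite big_nil; exact: cvg_cst.
under eq_fun do rewrite big_cons; rewrite big_cons.
by apply: cvgM ih; apply: cvgM; exact: flat1_cvg.
Qed.

Lemma box_bump_out m a b x : ~ cbox a b x -> box_bump m a b x = 0.
Proof.
move=> /existsNP[i] /negP; rewrite negb_and -!ltNge => h.
apply/eqP; rewrite prodf_seq_eq0; apply/hasP; exists i.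
  by rewrite mem_index_enum.
rewrite /= mulf_eq0; apply/orP.
by case/orP: h => h; [left|right]; rewrite /flat ltNge mulr_ge0_le0// subr_le0 ltW.
Qed.

Lemma compact_cbox a b : compact (cbox a b).
Proof.
have -> : cbox a b = [set v | forall i, (`[a 0 i, b 0 i]%classic : set R) (v ord0 i)].
  by apply/seteqP; split=> v h i; have := h i; rewrite /= in_itv.
apply: (@rV_compact _ _ (fun i => `[a 0 i, b 0 i]%classic)) => i.
exact: segment_compact.
Qed.

Lemma test_function_box_bump (Omega : set V) m a b :
  cbox a b `<=` Omega -> test_function Omega (box_bump m a b).
Proof.
move=> h; split; first exact: smooth_box_bump.
exists (cbox a b); split => //; first exact: compact_cbox.
by move=> x; exact: box_bump_out.
Qed.

End box_bump.

(** * The fundamental lemma of the calculus of variations *)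

Section cubes.
Context {R : realType}.

Definition cube {n} (M : R) : set 'rV[R]_n := [set v | forall i, - M <= v 0 i <= M].

Lemma measurable_cube n M : measurable (cube M : set 'rV[R]_n).
Proof.
rewrite (_ : cube M =
  \bigcap_(j in [set: 'I_n]) ((fun t : 'rV[R]_n => t 0 j) @^-1` `[- M, M])).
  apply: fin_bigcap_measurable => // j _; rewrite -[X in measurable X]setTI.
  by apply: measurable_coord => //; exact: measurable_itv.
apply/seteqP; split=> [v h j _|v h j]; first by rewrite /= in_itv/= h.
by have := h j Logic.I; rewrite /= in_itv.
Qed.

Lemma lebesgue_rV_cube n M : (lebesgue_rV n (cube M) < +oo)%E.
Proof.
elim: n => [|n ih]; first by rewrite /= diracE; case: (_ \in _); rewrite ltry.
rewrite /= /lebesgue_step /pushforward.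
(* In the coordinates of [rv_cons] the cube is an interval times a cube of one dimension less. *)
rewrite (_ : _ @^-1` _ = `[- M, M]%classic `*` cube M).
  rewrite product_measure1E//; last exact: measurable_cube.
  have L : (@lebesgue_measure R `[(- M)%R, M]%classic < +oo)%E.
    by rewrite lebesgue_measure_itv/=; case: ifP => _; rewrite ltry.
  by apply: lte_mul_pinfty => //; rewrite ge0_fin_numE.
apply/seteqP; split=> [[x v] h|[x v] [/= hx hv] i].
  split; first by have := h ord0; rewrite /= mxE unlift_none/= in_itv.
  by move=> i; have := h (lift ord0 i); rewrite mxE liftK.
rewrite mxE; case: (unliftP ord0 i) => [j _|_]/=; last by rewrite in_itv in hx.
exact: hv.
Qed.

Lemma lebesgue_rV_subcube n M (A : set 'rV[R]_n) : measurable A ->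
  A `<=` cube M -> (lebesgue_rV n A < +oo)%E.
Proof.
move=> mA AM; apply: le_lt_trans (lebesgue_rV_cube n M).
by apply: le_measure => //; rewrite inE//; exact: measurable_cube.
Qed.

End cubes.

(** * Borel sets of R^n and a generating pi-system *)

Section borel_rV.
Context {R : realType} {n : nat}.
Local Notation V := 'rV[R]_n.+1.
Implicit Types (a b : V) (O : set V).

Lemma measurable_obox a b : measurable (obox a b).
Proof.
rewrite (_ : obox a b =
  \bigcap_(j in [set: 'I_n.+1]) ((fun t : V => t 0 j) @^-1` `]a 0 j, b 0 j[)).
  apply: fin_bigcap_measurable => // j _; rewrite -[X in measurable X]setTI.
  by apply: measurable_coord => //; exact: measurable_itv.
apply/seteqP; split=> [v h j _|v h j]; first by rewrite /= in_itv/= h.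
by have := h j Logic.I; rewrite /= in_itv.
Qed.

(** The boxes with rational centre and radius are countable. The closed boxes, too, are required to
    lie in [O], because they contain the supports of the bumps. *)
Lemma open_bigcup_obox O : open O -> exists a b : nat -> V,
  (forall k, cbox (a k) (b k) `<=` O) /\ O = \bigcup_k obox (a k) (b k).
Proof.
move=> oO.
pose lo (p : 'rV[rat]_n.+1 * rat) : V := \row_i (ratr (p.1 0 i) - ratr p.2).
pose hi (p : 'rV[rat]_n.+1 * rat) : V := \row_i (ratr (p.1 0 i) + ratr p.2).
pose ok p := `[< cbox (lo p) (hi p) `<=` O >].
(* Indices that decode to no box, or to one that leaves [O], receive the empty box with lower corner
   1 and upper corner 0. *)
pose a k := if unpickle k is Some p then if ok p then lo p else const_mx 1
            else const_mx 1.
pose b k := if unpickle k is Some p then if ok p then hi p else const_mx 0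
            else const_mx 0.
have emp : cbox (const_mx 1) (const_mx 0 : V) `<=` O.
  by move=> v /(_ ord0); rewrite !mxE => h; exfalso; lra.
have cO k : cbox (a k) (b k) `<=` O.
  rewrite /a /b; case: unpickle => // p.
  by case: ifPn => // /asboolP.
exists a, b; split => //; apply/seteqP; split; last first.
  by move=> x [k _ xk]; apply: (cO k) => i; have /andP[? ?] := xk i; rewrite !ltW.
move=> x Ox; have /nbhs_ballP[r /= r0 rO] : nbhs x O by exact: open_nbhs_nbhs.
(* With a centre closer than [e] to [x] and radius [e < r / 2], each coordinate of a point of the
   closed box differs from that of [x] by less than [r]. *)
have [e /[!in_itv]/= /andP[e0 er]] : exists e : rat, ratr e \in `]0, r / 2[.
  by apply: rat_in_itvoo; rewrite divr_gt0.
have /choice[q hq] : forall i, exists q : rat,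
    ratr q \in `]x 0 i - ratr e, x 0 i + ratr e[.
  by move=> i; apply: rat_in_itvoo; lra.
pose p : 'rV[rat]_n.+1 * rat := (\row_i q i, e).
have okp : ok p.
  apply/asboolP => y hy; apply: rO; split => // i j; rewrite !ord1 /ball/=.
  have := hy j; have := hq j; rewrite in_itv/= !mxE => /andP[? ?] /andP[? ?].
  by rewrite ltr_norml; apply/andP; split; lra.
exists (pickle p) => // i; rewrite /a /b pickleK okp !mxE.
by have := hq i; rewrite in_itv/= => /andP[? ?]; apply/andP; split; lra.
Qed.

Lemma open_measurable_rV O : open O -> measurable O.
Proof.
move=> /open_bigcup_obox[a [b [_ ->]]].
by apply: bigcupT_measurable => k; exact: measurable_obox.
Qed.

Lemma closed_measurable_rV O : closed O -> measurable O.
Proof.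
move=> cO; rewrite -(setCK O); apply: measurableC.
by apply: open_measurable_rV; exact: closed_openC.
Qed.

Lemma continuous_measurable_rV (f : V -> R) D : continuous f -> measurable_fun D f.
Proof.
move=> cf; apply: (@measurable_funS _ _ _ _ setT) => //.
apply: (measurability _ (RGenInftyO.measurableE R)) => _ [_ [c ->] <-].
rewrite setTI; apply: open_measurable_rV; apply: open_comp.
  by move=> x _; exact: cf.
by rewrite set_itvE; exact: open_lt.
Qed.

(** These sets are closed under intersection, generate the Borel sets, and cut an open box in an
    open box with the same lower corner. *)
Definition orthant (c : V) : set V := [set v | forall i, v 0 i < c 0 i].

Lemma orthant_setI_closed : setI_closed (range orthant).
Proof.
move=> _ _ [c _ <-] [c' _ <-]; exists (\row_i Num.min (c 0 i) (c' 0 i)) => //.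
apply/seteqP; split=> v.
  by move=> h; split=> i; have := h i; rewrite mxE lt_min => /andP[].
by move=> [h h'] i; rewrite mxE lt_min h h'.
Qed.

Lemma obox_setI_orthant a b c :
  obox a b `&` orthant c = obox a (\row_i Num.min (b 0 i) (c 0 i)).
Proof.
apply/seteqP; split=> v.
  by move=> [h h'] i; rewrite mxE lt_min h' andbT; exact: h.
by move=> h; split=> i; have := h i; rewrite mxE lt_min => /and3P[h1 h2 h3] //;
  apply/andP.
Qed.

Lemma measurable_orthant c : measurable (orthant c).
Proof.
rewrite (_ : orthant c =
  \bigcap_(j in [set: 'I_n.+1]) ((fun t : V => t 0 j) @^-1` `]-oo, c 0 j[)).
  apply: fin_bigcap_measurable => // j _; rewrite -[X in measurable X]setTI.
  by apply: measurable_coord => //; exact: measurable_itv.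
apply/seteqP; split=> [v h j _|v h j]; first by rewrite /= in_itv/= h.
by have := h j Logic.I; rewrite /= in_itv.
Qed.

Lemma measurable_rVE : @measurable _ V = <<s range orthant >>.
Proof.
apply/seteqP; split; last first.
  apply: smallest_sub; first exact: (@sigma_algebra_measurable _ V).
  by move=> _ [c _ <-]; exact: measurable_orthant.
apply: smallest_sub; first exact: smallest_sigma_algebra.
move=> _ [i [B [mB ->]]]; rewrite -[X in _ X]setTI.
suff h : measurable_fun setT
    ((fun v => v 0 i) : g_sigma_algebraType (range orthant) -> measurableTypeR R).
  exact: h.
apply: (measurability _ (RGenInftyO.measurableE R)) => _ [_ [r ->] <-].
(* The half-space where the [i]-th coordinate is below [r] is exhausted by orthants whose other
   bounds tend to infinity. *)
rewrite setTI (_ : _ @^-1` _ = \bigcup_(k : nat)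
    orthant (\row_j if j == i then r else k%:R)); last first.
  apply/seteqP; split=> v /=.
    rewrite in_itv/= => vr.
    have [k hk] : exists k : nat, forall j, v 0 j < k%:R.
      exists (\sum_j (Num.truncn (`|v 0 j|)%R).+1)%N => j.
      apply: le_lt_trans (ler_norm _) _; apply: lt_le_trans (truncnS_gt _) _.
      by rewrite ler_nat (bigD1 j)//= leq_addr.
    by exists k => // j; rewrite mxE; case: eqP => [->|].
  by move=> [k _ /(_ i)]; rewrite mxE eqxx in_itv.
apply: bigcupT_measurable => k; apply: sub_sigma_algebra.
by eexists.
Qed.

End borel_rV.

(** * Integrals and equality almost everywhere *)

Section ae_lemmas.
Context d (X : measurableType d) (R : realType) (mu : {measure set X -> \bar R}).
Implicit Types (D : set X) (f z : X -> R).

Lemma Rintegral_ge0_eq0 D f : measurable D -> mu.-integrable D (EFin \o f) ->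
  (forall x, D x -> 0 <= f x) -> \int[mu]_(x in D) f x = 0 ->
  {ae mu, forall x, D x -> f x = 0}.
Proof.
move=> mD fi f0 h.
have e : (\int[mu]_(x in D) `|(f x)%:E| = 0)%E.
  rewrite (eq_integral (EFin \o f)); last first.
    by move=> x; rewrite inE => Dx; rewrite gee0_abs// lee_fin f0.
  by rewrite -[LHS]fineK ?integrable_fin_num//; congr EFin.
have := (ae_eq_integral_abs mu mD (measurable_int _ fi)).1 e.
by apply: filterS => x h1 Dx; have := h1 Dx; rewrite /= => -[].
Qed.

Lemma ae_eq_Rintegral D f z : measurable D -> measurable_fun D f ->
  measurable_fun D z -> {ae mu, forall x, D x -> f x = z x} ->
  \int[mu]_(x in D) f x = \int[mu]_(x in D) z x.
Proof.
move=> mD mf mz fz; congr fine; apply: ae_eq_integral => //; try exact/measurable_EFinP.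
by apply: filterS fz => x h Dx; rewrite h.
Qed.

End ae_lemmas.

(** * One function tested against bumps under finitely many measures *)

Section fundamental_lemma.
Context {R : realType} {n : nat} (I : finType) (P : pred I).
Local Notation V := 'rV[R]_n.+1.
Variables (m : I -> {measure set V -> \bar R}) (D : set V) (z : V -> R).
Hypotheses (mD : measurable D)
  (zi : forall i, P i -> (m i).-integrable D (EFin \o z)).

Let iS A i : P i -> measurable A -> A `<=` D -> (m i).-integrable A (EFin \o z).
Proof. by move=> Pi mA AD; exact: integrableS (zi Pi). Qed.

(** Dominated convergence with majorant [|z|], as the bumps take values between 0 and 1. *)
Lemma cvg_Rintegral_bump i a b : P i ->
  \int[m i]_(x in D) (z x * box_bump k a b x) @[k --> \oo] -->
  \int[m i]_(x in D `&` obox a b) z x.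
Proof.
move=> Pi; rewrite Rintegral_mkcondr.
have mz : measurable_fun D z by apply/measurable_EFinP; exact: measurable_int (zi Pi).
have mb k : measurable_fun D (box_bump k a b).
  apply: continuous_measurable_rV.
  exact: (of_class_C_continuous (@smooth_box_bump _ _ k a b 0)).
have E : z \_ (obox a b) = (fun x => z x * \1_(obox a b) x).
  by apply/funext => x; rewrite patchE indicE; case: ifP => _; rewrite ?mulr1 ?mulr0.
have [] := @dominated_convergence _ _ _ (m i) D mD
   (fun k x => (z x * box_bump k a b x)%:E) (EFin \o (z \_ (obox a b)))
   (fun x => `|(z x)%:E|%E).
- by move=> k; apply/measurable_EFinP; exact: measurable_funM.
- apply/measurable_EFinP; rewrite E; apply: measurable_funM => //.
  by apply: measurable_indic; exact: measurable_obox.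
- apply: aeW => x Dx; rewrite E /=; apply: cvg_EFin; first exact: nearW.
  by apply: cvgMr; exact: cvg_box_bump.
- exact: integrable_abse (zi Pi).
- apply: aeW => x k Dx /=; rewrite lee_fin normrM ler_piMr//.
  by have /andP[b0 b1] := box_bump_bounds k a b x; rewrite ger0_norm.
move=> zi' _; rewrite -[X in _ --> X -> _]fineK; last exact: integrable_fin_num.
by move/fine_cvg.
Qed.

Lemma sum_Rintegral_obox_eq0 a b :
  (forall k, \sum_(i | P i) \int[m i]_(x in D) (z x * box_bump k a b x) = 0) ->
  \sum_(i | P i) \int[m i]_(x in D `&` obox a b) z x = 0.
Proof.
move=> h; have : (fun k => \sum_(i | P i) \int[m i]_(x in D) (z x * box_bump k a b x))
    @ \oo --> \sum_(i | P i) \int[m i]_(x in D `&` obox a b) z x.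
  apply: cvg_big; first exact: add_continuous.
  by move=> i Pi; exact: cvg_Rintegral_bump.
rewrite (_ : (fun _ => _) = cst 0); last by apply/funext => k; exact: h.
by move=> /(cvg_unique (@Rhausdorff R) (cvg_cst 0)) <-.
Qed.

(** The sets [S] with zero sum form a Dynkin system that contains the orthants. Intersecting with an
    orthant moves only the upper corner of the box, hence the single varying corner [b'] in the
    hypothesis. *)
Lemma sum_Rintegral_measurable_eq0 a b :
  (forall b' k, cbox a b' `<=` cbox a b ->
     \sum_(i | P i) \int[m i]_(x in D) (z x * box_bump k a b' x) = 0) ->
  forall S, measurable S ->
    \sum_(i | P i) \int[m i]_(x in D `&` obox a b `&` S) z x = 0.
Proof.
move=> h S; rewrite measurable_rVE; move: S.
set E := D `&` obox a b.
have mE : measurable E by apply: measurableI => //; exact: measurable_obox.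
have ED A : E `&` A `<=` D by move=> x [[]].
have hE : \sum_(i | P i) \int[m i]_(x in E) z x = 0.
  by apply: sum_Rintegral_obox_eq0 => k; exact: h.
apply: (@dynkin_induction _ V _ _ measurable_rVE orthant_setI_closed).
- by rewrite setIT.
- move=> _ [c _ <-]; rewrite /E -setIA obox_setI_orthant.
  apply: sum_Rintegral_obox_eq0 => k; apply: h => x hx i.
  by have := hx i; rewrite mxE le_min => /and3P[-> ->].
- move=> S mS hS.
  suff -> : \sum_(i | P i) \int[m i]_(x in E `&` ~` S) z x =
      \sum_(i | P i) \int[m i]_(x in E) z x -
      \sum_(i | P i) \int[m i]_(x in E `&` S) z x by rewrite hE hS subr0.
  rewrite -sumrB; apply: eq_bigr => i Pi; apply/eqP; rewrite eq_sym subr_eq; apply/eqP.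
  rewrite addrC -Rintegral_setU//.
  + by rewrite -setIUr setUCr setIT.
  + exact: measurableI.
  + by apply: measurableI => //; exact: measurableC.
  + rewrite -setIUr; apply: iS => //; apply: measurableI => //.
    by apply: measurableU => //; exact: measurableC.
  + by apply/disj_setPS => x [[_ ?] [_ ?]].
- move=> F mF tF hF.
  have mEF k : measurable (E `&` F k) by exact: measurableI.
  have iEF i : P i -> (m i).-integrable (\bigcup_k (E `&` F k)) (EFin \o z).
    move=> Pi; apply: iS => //; first exact: bigcupT_measurable.
    by move=> x [k _ [[]]].
  have : (fun N => \sum_(i | P i) \sum_(0 <= k < N) \int[m i]_(x in E `&` F k) z x)
      @ \oo --> \sum_(i | P i) \int[m i]_(x in E `&` \bigcup_k F k) z x.
    apply: cvg_big; first exact: add_continuous.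
    move=> i Pi.
    (* Countable additivity is that of the charge induced by [z], extended by zero outside [E]. *)
    have zE : (m i).-integrable setT ((EFin \o z) \_ E).
      by apply: (integrable_mkcond _ mE).1; apply: iS => // x [].
    have mUF : measurable (\bigcup_k F k) by exact: bigcupT_measurable.
    have : (fun N => \sum_(0 <= k < N) \int[m i]_(x in F k) ((EFin \o z) \_ E) x)%E @ \oo
        --> (\int[m i]_(x in \bigcup_k F k) ((EFin \o z) \_ E) x)%E.
      exact: (@charge_semi_sigma_additive _ _ _ (induced_charge zE) F mF tF mUF).
    rewrite -integral_mkcondl.
    rewrite -[X in _ --> X -> _]fineK; last first.
      apply: integrable_fin_num; first exact: measurableI.
      by rewrite setI_bigcupr; exact: iEF.
    move/fine_cvg; apply: cvg_trans; apply: near_eq_cvg; apply: nearW => N /=.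
    under eq_bigr do rewrite -integral_mkcondl.
    rewrite sum_fine//; move=> k _; apply: integrable_fin_num => //.
    by apply: iS => //; exact: ED.
  rewrite (_ : (fun _ => _) = cst 0).
    by move=> /(cvg_unique (@Rhausdorff R) (cvg_cst 0)) <-.
  apply/funext => N; rewrite exchange_big big1// => k _; exact: hF.
Qed.

(** The tests control only the sum of the integrals over the family. Where [z] is positive, all
    these integrals are nonnegative, so a zero sum makes each of them vanish; the set where [z] is
    negative is treated in the same way. *)
Lemma ae_eq0_bump (O : set V) : open O ->
  (forall a b k, cbox a b `<=` O ->
     \sum_(i | P i) \int[m i]_(x in D) (z x * box_bump k a b x) = 0) ->
  forall i, P i -> {ae m i, forall x, D x -> O x -> z x = 0}.
Proof.
move=> oO h i Pi; have [a [b [abO OE]]] := open_bigcup_obox oO.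
suff H k : {ae m i, forall x, D x -> obox (a k) (b k) x -> z x = 0}.
  have := ae_foralln H.
  by apply: filterS => x hx Dx; rewrite OE => -[k _]; exact: hx.
have hS := @sum_Rintegral_measurable_eq0 (a k) (b k)
  (fun b' k' hc => h _ _ _ (subset_trans hc (abO k))).
set E := D `&` obox (a k) (b k).
have mE : measurable E by apply: measurableI => //; exact: measurable_obox.
have mz : measurable_fun D z by apply/measurable_EFinP; exact: measurable_int (zi Pi).
have mp : measurable (D `&` z @^-1` `]0, +oo[) by apply: mz => //; exact: measurable_itv.
have mn : measurable (D `&` z @^-1` `]-oo, 0[) by apply: mz => //; exact: measurable_itv.
have hp : {ae m i, forall x, (E `&` (D `&` z @^-1` `]0, +oo[)) x -> z x = 0}.
  apply: Rintegral_ge0_eq0.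
  - exact: measurableI.
  - by apply: iS => //; [exact: measurableI|move=> x [[]]].
  - by move=> x [_ [_ /=]]; rewrite in_itv/= andbT => /ltW.
  - have := hS _ mp => /eqP; rewrite psumr_eq0; last first.
      by move=> j _; apply: Rintegral_ge0 => x [_ [_ /=]]; rewrite in_itv/= andbT => /ltW.
    by move=> /allP/(_ i); rewrite mem_index_enum Pi => /(_ isT)/eqP.
have hn : {ae m i, forall x, (E `&` (D `&` z @^-1` `]-oo, 0[)) x -> - z x = 0}.
  have rN j : P j -> \int[m j]_(x in E `&` (D `&` z @^-1` `]-oo, 0[)) (- z x) =
      - \int[m j]_(x in E `&` (D `&` z @^-1` `]-oo, 0[)) z x.
    move=> Pj; rewrite -mulN1r -RintegralZl.
    + by apply: eq_Rintegral => x _; rewrite mulN1r.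
    + exact: measurableI.
    + by apply: iS => //; [exact: measurableI|move=> x [[]]].
  apply: Rintegral_ge0_eq0.
  - exact: measurableI.
  - rewrite (_ : EFin \o _ = (-%E \o (EFin \o z)))//; apply: integrableN.
    by apply: iS => //; [exact: measurableI|move=> x [[]]].
  - by move=> x [_ [_ /=]]; rewrite in_itv/= oppr_ge0 => /ltW.
  - have : \sum_(j | P j) \int[m j]_(x in E `&` (D `&` z @^-1` `]-oo, 0[)) (- z x) = 0.
      rewrite -[RHS]oppr0 -[in RHS](hS _ mn) -sumrN; apply: eq_bigr => j Pj.
      exact: rN.
    move=> /eqP; rewrite psumr_eq0; last first.
      move=> j _; apply: Rintegral_ge0 => x [_ [_ /=]].
      by rewrite in_itv/= oppr_ge0 => /ltW.
    by move=> /allP/(_ i); rewrite mem_index_enum Pi => /(_ isT)/eqP.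
apply: filterS2 hp hn => x h1 h2 Dx abx.
have [z0|z0|//] := ltgtP (z x) 0.
- apply/eqP; rewrite -oppr_eq0; apply/eqP; apply: h2.
  by split; [split|split=> //=; rewrite in_itv].
- by apply: h1; split; [split|split=> //=; rewrite in_itv/= z0].
Qed.

End fundamental_lemma.

(** * Boundary faces and the inflow boundary *)

Section euclidean.
Context {R : realType} {n : nat}.
Local Notation V := 'rV[R]_n.
Implicit Types (u v w : V) (A : set V).

Lemma dotvC u v : dotv u v = dotv v u.
Proof. by apply: eq_bigr => i _; rewrite mulrC. Qed.

Lemma dotvDl u v w : dotv (u + v) w = dotv u w + dotv v w.
Proof. by rewrite -big_split; apply: eq_bigr => i _; rewrite mxE mulrDl. Qed.

Lemma dotvZl a u v : dotv (a *: u) v = a * dotv u v.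
Proof. by rewrite mulr_sumr; apply: eq_bigr => i _; rewrite mxE mulrA. Qed.

Lemma dotvBl u v w : dotv (u - v) w = dotv u w - dotv v w.
Proof. by rewrite dotvDl -scaleN1r dotvZl mulN1r. Qed.

Lemma dotv0l u : dotv 0 u = 0.
Proof. by rewrite -(scale0r 0) dotvZl mul0r. Qed.

Lemma dotv_ge0 u : 0 <= dotv u u.
Proof. by apply: sumr_ge0 => i _; rewrite -expr2 sqr_ge0. Qed.

Lemma sqr_coord_le u i : u 0 i ^+ 2 <= dotv u u.
Proof.
rewrite /dotv (bigD1 i)//= -expr2 lerDl.
by apply: sumr_ge0 => j _; rewrite -expr2 sqr_ge0.
Qed.

Lemma dotv_le0 u : dotv u u <= 0 -> u = 0.
Proof.
move=> u0; apply/rowP => i; rewrite mxE; apply/eqP; rewrite -sqrf_eq0 eq_le.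
by rewrite sqr_ge0 andbT (le_trans (sqr_coord_le u i)).
Qed.

Lemma enorm_ge0 u : 0 <= enorm u. Proof. exact: sqrtr_ge0. Qed.

Lemma enormZ a u : enorm (a *: u) = `|a| * enorm u.
Proof.
rewrite /enorm dotvZl dotvC dotvZl mulrA -expr2 sqrtrM ?sqr_ge0//.
by rewrite sqrtr_sqr.
Qed.

Lemma coord_le_enorm u i : `|u 0 i| <= enorm u.
Proof.
by rewrite -sqrtr_sqr /enorm ler_sqrt ?sqr_coord_le// dotv_ge0.
Qed.

Lemma enorm_lt_scale u (r : R) : 0 < r -> exists2 e : R, 0 < e & enorm (e *: u) < r.
Proof.
move=> r0; have u1 : 0 < enorm u + 1 by rewrite ltr_wpDl// enorm_ge0.
(* The summand 1 covers the case [u = 0]. *)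
exists (r / (enorm u + 1)); first exact: divr_gt0.
rewrite enormZ gtr0_norm ?divr_gt0// mulrAC ltr_pdivrMr// ltr_pM2l// ltrDl.
exact: ltr01.
Qed.

Lemma diam_ge0 A : 0 <= diam A.
Proof.
rewrite /diam; set S := (X in sup X).
have S0 x : S x -> 0 <= x by move=> [y _ [z _ <-]]; exact: enorm_ge0.
(* A set without supremum has the default [sup] 0. *)
have [hS|/sup_out ->//] := pselect (has_sup S).
have [[x Sx] ub] := hS.
by apply: le_trans (S0 _ Sx) _; exact: ub_le_sup.
Qed.

Lemma convex_hull_convex A u v (l : R) : 0 <= l <= 1 ->
  convex_hull A u -> convex_hull A v -> convex_hull A (l *: u + (1 - l) *: v).
Proof.
move=> /andP[l0 l1] hu hv B [cB AB]; have Bu := hu B (conj cB AB).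
have Bv := hv B (conj cB AB).
have := cB u v (Itv01 l0 l1); rewrite !inE => /(_ Bu Bv).
by [].
Qed.

(** Induction on the number of points: the first point is combined with the mean of the others,
    renormalised by their total weight [s]; the case [s = 0] is separate. *)
Lemma convex_hull_sum A k (F : 'I_k -> V) (t : 'I_k -> R) :
  (forall j, A (F j)) -> (forall j, 0 <= t j) -> \sum_j t j = 1 ->
  convex_hull A (\sum_j t j *: F j).
Proof.
elim: k F t => [|k ih] F t AF t0.
  by rewrite big_ord0 => /eqP; rewrite eq_sym oner_eq0.
rewrite !big_ord_recl => t1.
have AF0 : convex_hull A (F ord0) by move=> B [_ AB]; exact: AB.
set s := \sum_(j < k) t (lift ord0 j) in t1 *.
have s1 : s = 1 - t ord0 by rewrite -t1 addrC addKr.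
have s0 : 0 <= s by exact: sumr_ge0.
have [s00|sn0] := eqVneq s 0.
  have tj0 j : t (lift ord0 j) = 0.
    move/eqP: s00; rewrite psumr_eq0// => /allP/(_ j).
    by rewrite mem_index_enum => /(_ isT)/eqP.
  rewrite big1 ?addr0 => [|j _]; last by rewrite tj0 scale0r.
  by move: t1; rewrite s00 addr0 => ->; rewrite scale1r.
rewrite (_ : \sum_(i < k) _ =
    (1 - t ord0) *: \sum_(i < k) (t (lift ord0 i) / s) *: F (lift ord0 i)).
  apply: convex_hull_convex => //.
    by rewrite t0 -subr_ge0 -s1.
  apply: ih => // [j|]; first by rewrite divr_ge0.
  by rewrite -mulr_suml divff.
rewrite -s1 scaler_sumr; apply: eq_bigr => j _.
by rewrite scalerA mulrCA divff// mulr1.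
Qed.

End euclidean.

(** * The surface measure of a facet *)

Section faces.
Context {R : realType} {n : nat}.
Local Notation V := 'rV[R]_n.+1.

Lemma face_param_convex_hull (p : 'I_n.+2 -> V) i t : unit_simplex t ->
  convex_hull (range (fun j => p (lift i j))) (face_param p i t).
Proof.
move=> [t0 t1].
(* Barycentric coordinates: the first vertex of the face takes the remaining weight
   [1 - \sum_k t 0 k]. *)
have -> : face_param p i t = \sum_(j < n.+1)
    (if unlift ord0 j is Some k then t 0 k else 1 - \sum_k t 0 k) *: p (lift i j).
  rewrite big_ord_recl unlift_none.
  rewrite [X in _ + X](eq_bigr (fun k => t 0 k *: p (lift i (lift ord0 k)))) => [|k _];
    last by rewrite liftK.
  rewrite /face_param mulmx_sum_row scalerBl scale1r -addrA; congr (_ + _).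
  rewrite scaler_suml addrC -sumrB; apply: eq_bigr => k _.
  by rewrite rowK scalerBr.
apply: convex_hull_sum => [j|j|].
- by exists j.
- by case: unliftP => [k _|_] //; rewrite subr_ge0.
- rewrite big_ord_recl unlift_none.
  rewrite [X in _ + X](eq_bigr (t 0)) => [|k _]; last by rewrite liftK.
  by rewrite subrK.
Qed.

Variable T : mesh R n.

(** The parametrization sends the unit simplex into the facet, so no parameter in that simplex is
    sent outside [B]. *)
Lemma ae_surf (F : facet T) (B : set V) : measurable B -> facet_set F `<=` B ->
  {ae surf F, forall x, B x}.
Proof.
move=> mB FB; exists (~` B); split=> //; first exact: measurableC.
rewrite /surf /= /face_measure (_ : _ `&` _ = set0) ?measure0 ?mule0//.
rewrite -subset0 => t [st]; apply; apply: FB.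
exact: face_param_convex_hull.
Qed.

Lemma surf_lty (F : facet T) A : measurable A -> (surf F A < +oo)%E.
Proof.
move=> mA; rewrite /surf /= /face_measure.
have mP : measurable (@unit_simplex R n `&` face_param (vertex F.1) F.2 @^-1` A).
  apply: measurableI; first exact: measurable_unit_simplex.
  by rewrite -[X in measurable X]setTI; exact: measurable_face_param.
apply: lte_mul_pinfty; [by rewrite lee_fin sqrtr_ge0|by []|].
apply: (@lebesgue_rV_subcube _ _ 1) => // t [[t0 t1] _] j.
rewrite (le_trans _ (t0 j)) ?lerN10//= (le_trans _ t1)// (bigD1 j)//= lerDl.
exact: sumr_ge0.
Qed.

End faces.

(** * Outward normals, the inflow boundary and bounded domains *)

Section domain.
Context {R : realType} {n : nat}.
Local Notation V := 'rV[R]_n.+1.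
Implicit Types (Omega A : set V) (beta : V -> V) (x y nu : V).

Lemma continuous_rV_coord i : continuous (fun y : V => y 0 i).
Proof. by move=> x; exact: coord_continuous. Qed.

Lemma continuous_rV_sum (I : Type) (s : seq I) (F : I -> V -> R) :
  (forall i, continuous (F i)) -> continuous (fun y => \sum_(i <- s) F i y).
Proof.
move=> hF; elim: s => [|i s ih].
  by under eq_fun do rewrite big_nil; exact: continuous_rV_cst.
by under eq_fun do rewrite big_cons; exact: continuous_rVD.
Qed.

Lemma continuous_dotvl x nu : continuous (fun y : V => dotv (y - x) nu).
Proof.
apply: continuous_rV_sum => i; apply: continuous_rVM; last exact: continuous_rV_cst.
rewrite (_ : (fun _ => _) = (fun y : V => y 0 i + - x 0 i)).
  by apply: continuous_rVD; [exact: continuous_rV_coord|exact: continuous_rV_cst].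
by apply/funext => y; rewrite !mxE.
Qed.

Lemma near_continuous_lt (f : V -> R) x (c : R) : continuous f -> f x < c ->
  \forall y \near x, f y < c.
Proof. by move=> cf fxc; exact: (cf x _ (lt_nbhsl fxc)). Qed.

(** The topology is that of the maximum norm, whereas domains and normals are described by Euclidean
    balls. *)
Lemma nbhs_enormP x A :
  nbhs x A <-> exists2 r : R, 0 < r & forall y, enorm (y - x) < r -> A y.
Proof.
split=> [/nbhs_ballP[r /= r0 rA]|[r r0 rA]].
  exists r => // y yx; apply: rA; split=> // i j; rewrite !ord1 /ball/= distrC.
  apply: le_lt_trans yx; apply: le_trans (coord_le_enorm _ j).
  by rewrite !mxE.
have : \forall y \near x, dotv (y - x) (y - x) < r ^+ 2.
  apply: near_continuous_lt; last by rewrite subrr dotv0l exprn_gt0.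
  apply: continuous_rV_sum => i; rewrite (_ : (fun _ => _) =
      (fun y : V => (y 0 i + - x 0 i) * (y 0 i + - x 0 i))).
    have h : continuous (fun y : V => y 0 i + - x 0 i).
      apply: continuous_rVD; first exact: continuous_rV_coord.
      exact: continuous_rV_cst.
    exact: continuous_rVM.
  by apply/funext => y; rewrite !mxE.
apply: filterS => y hy; apply: rA.
by rewrite /enorm -[r]gtr0_norm// -sqrtr_sqr ltr_sqrt ?exprn_gt0.
Qed.

(** By scaling, the two local half-spaces agree globally. If [dotv nu nu'] were below 1, [nu' - nu]
    would lie in the first half-space but not in the second. Hence it is at least 1, and the squared
    norm 2 - 2 [dotv nu nu'] of the difference is at most 0. *)
Lemma is_outward_normal_unique Omega x nu nu' :
  is_outward_normal Omega x nu -> is_outward_normal Omega x nu' -> nu = nu'.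
Proof.
move=> [nu1 [r r0 hr]] [nu1' [r' r0' hr']].
have E w : dotv w nu < 0 <-> dotv w nu' < 0.
  have [e e0 he] := enorm_lt_scale w (r := Num.min r r') ltac:(by rewrite lt_min r0).
  move: he; rewrite lt_min => /andP[h h'].
  have := hr (e *: w + x); have := hr' (e *: w + x); rewrite addrK => /(_ h') H' /(_ h) H.
  have : dotv (e *: w) nu < 0 <-> dotv (e *: w) nu' < 0 by rewrite -H -H'.
  by rewrite !dotvZl !pmulr_rlt0.
have d1 v : enorm v = 1 -> dotv v v = 1.
  by move=> v1; rewrite -[LHS]sqr_sqrtr ?dotv_ge0// -/(enorm v) v1 expr1n.
have s1 : 1 <= dotv nu nu'.
  rewrite leNgt; apply/negP => s1.
  have /E : dotv (nu' - nu) nu < 0 by rewrite dotvBl dotvC d1// subr_lt0.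
  by rewrite dotvBl d1// subr_lt0 ltNge ltW.
apply/eqP; rewrite -subr_eq0; apply/eqP; apply: dotv_le0.
rewrite dotvBl ![dotv _ (nu - nu')]dotvC !dotvBl !d1// [dotv nu' nu]dotvC.
by lra.
Qed.

(** A boundary point [y] near [x] lies on the hyperplane through [x]: on its negative side [y] would
    be interior, on its positive side outside the closure. The half-spaces at [x] and [y] then
    coincide. *)
Lemma near_is_outward_normal Omega x nu : is_outward_normal Omega x nu ->
  \forall y \near x, bdry Omega y -> is_outward_normal Omega y nu.
Proof.
move=> [nu1 [r r0 hr]].
have nx : \forall y \near x, enorm (y - x) < r by apply/nbhs_enormP; exists r.
have := nbhs_interior nx; apply: filterS => y Iy [cy niy].
have y0 : dotv (y - x) nu = 0.
  have [yneg|ypos|//] := ltgtP (dotv (y - x) nu) 0.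
    exfalso; apply: niy.
    have := near_continuous_lt (@continuous_dotvl x nu) yneg.
    by move=> h; apply: filterS2 Iy h => z zr zneg; apply/hr.
  exfalso.
  have h : \forall z \near y, - dotv (z - x) nu < 0.
    apply: (@near_continuous_lt (fun z => - dotv (z - x) nu)); last by rewrite oppr_lt0.
    move=> z; apply: (@continuousN _ R^o _ (fun z : V => dotv (z - x) nu)).
    exact: continuous_dotvl.
  have /(_ _ (filterI Iy h))[z [Oz [zr zp]]] := cy _.
  by move: zp; rewrite oppr_lt0 ltNge ltW//; apply/hr.
split=> //; have [e e0 he] := (nbhs_enormP y _).1 Iy.
exists e => // z /he /hr ->.
have -> : dotv (z - x) nu = dotv (z - y) nu + dotv (y - x) nu.
  by rewrite -dotvDl subrKA.
by rewrite y0 addr0.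
Qed.

Lemma normalP Omega x nu : is_outward_normal Omega x nu -> normal Omega x = nu.
Proof.
move=> h; apply: is_outward_normal_unique (h).
by apply: (@xgetPex _ 0 (is_outward_normal Omega x)); exists nu.
Qed.

(** Without an outward normal, [normal] is the default 0 and [betan] vanishes. *)
Lemma betan_neq0_is_outward_normal Omega beta x : betan Omega beta x != 0 ->
  is_outward_normal Omega x (normal Omega x).
Proof.
move=> b0; apply: (@xgetPex _ 0 (is_outward_normal Omega x)).
apply: contrapT => h; move: b0.
rewrite /betan /normal (@xgetPN _ 0 (is_outward_normal Omega x)).
  by rewrite dotvC dotv0l eqxx.
by move=> nu hnu; apply: h; exists nu.
Qed.

Lemma within_continuous_coord Omega beta j : {within closure Omega, continuous beta} ->
  {within closure Omega, continuous (fun x => beta x 0 j)}.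
Proof.
move=> cb; apply/subspace_continuousP => x cx.
apply: (@cvg_comp _ _ _ beta (fun v : V => v 0 j)).
  exact: (subspace_continuousP _ _).1 cb x cx.
exact: coord_continuous.
Qed.

(** Since [c <= 0], [betan] is nonzero at [x], so there is a genuine normal there and it is the same
    at nearby boundary points. Near [x], [betan] is thus the product of a continuous field with a
    fixed vector. *)
Lemma near_betan_lt Omega beta x (c : R) : {within closure Omega, continuous beta} ->
  c <= 0 -> bdry Omega x -> betan Omega beta x < c ->
  \forall y \near x, bdry Omega y -> betan Omega beta y < c.
Proof.
move=> cbeta c0 bx xc.
have hn : is_outward_normal Omega x (normal Omega x).
  by apply: (@betan_neq0_is_outward_normal _ beta); rewrite lt_eqF// (lt_le_trans xc).
have := (subspace_continuousP _ _).1 cbeta x bx.1 => cb.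
have h : \forall v \near beta x, dotv v (normal Omega x) < c.
  have := @near_continuous_lt _ (beta x) c (@continuous_dotvl 0 (normal Omega x)).
  by rewrite subr0 => /(_ xc); apply: filterS => v; rewrite subr0.
have h1 : \forall y \near x, closure Omega y -> dotv (beta y) (normal Omega x) < c.
  exact: cb _ h.
apply: filterS2 h1 (near_is_outward_normal hn) => y hy /[swap] by_ /(_ by_) /normalP ny.
by rewrite /betan ny; apply: hy; exact: by_.1.
Qed.

Lemma betan_lt_open Omega beta (c : R) : {within closure Omega, continuous beta} ->
  c <= 0 -> exists2 O, open O &
    [set x | bdry Omega x /\ betan Omega beta x < c] = O `&` bdry Omega.
Proof.
move=> cb c0; exists (interior [set y | bdry Omega y -> betan Omega beta y < c]).
  exact: open_interior.
apply/seteqP; split=> x.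
  by move=> [bx xc]; split=> //; exact: near_betan_lt.
by move=> [/interior_subset h bx]; split=> //; exact: h.
Qed.

Lemma measurable_bdry Omega : measurable (bdry Omega).
Proof.
apply: measurableD.
  by apply: closed_measurable_rV; exact: closed_closure.
by apply: open_measurable_rV; exact: open_interior.
Qed.

Lemma measurable_inflow Omega beta : {within closure Omega, continuous beta} ->
  measurable (inflow Omega beta).
Proof.
move=> cb; have [W oW] := betan_lt_open cb (lexx 0).
rewrite /inflow => ->; apply: measurableI; last exact: measurable_bdry.
exact: open_measurable_rV.
Qed.

Lemma measurable_fun_betan Omega beta : {within closure Omega, continuous beta} ->
  measurable_fun (inflow Omega beta) (betan Omega beta).
Proof.
move=> cb; apply: (measurability _ (RGenInftyO.measurableE R)) => _ [_ [c ->] <-].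
(* Above level 0 the condition holds on the whole inflow boundary; for [c <= 0] it is relatively
   open in the boundary. *)
have [c0|/ltW c0] := leP c 0; last first.
  rewrite (_ : _ `&` _ = inflow Omega beta); first exact: measurable_inflow.
  apply/seteqP; split=> x; first by case.
  by move=> hx; split=> //=; rewrite in_itv/= (lt_le_trans hx.2).
have [W oW OE] := betan_lt_open cb c0.
rewrite (_ : _ `&` _ = W `&` bdry Omega).
  by apply: measurableI; [exact: open_measurable_rV|exact: measurable_bdry].
rewrite -OE; apply/seteqP; split=> x /=.
  by rewrite in_itv/= => -[[bx _] xc].
by move=> [bx xc]; rewrite in_itv/=; split=> //; split=> //; exact: lt_le_trans c0.
Qed.

Lemma measurable_fun_within Omega (f : V -> R) : open Omega ->
  {within closure Omega, continuous f} -> measurable_fun Omega f.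
Proof.
move=> oO cf; apply: (measurability _ (RGenInftyO.measurableE R)) => _ [_ [c ->] <-].
apply: open_measurable_rV; rewrite openE => x [Ox].
rewrite /= in_itv/= => fxc.
have := (subspace_continuousP _ _).1 cf x (subset_closure Ox) => cfx.
have h : \forall y \near x, closure Omega y -> f y < c.
  exact: cfx _ (lt_nbhsl fxc).
have nO : \forall y \near x, Omega y by exact: open_nbhs_nbhs.
apply: filterS2 nO h => y Oy hy; split=> //=; rewrite in_itv/=.
by apply: hy; exact: subset_closure.
Qed.

Lemma bounded_sub_cube Omega : bounded_set Omega -> exists M : R, Omega `<=` cube M.
Proof.
move=> [M [Mreal hM]]; exists (M + 1) => v /(hM (M + 1) ltac:(by rewrite ltrDl)) vM i.
rewrite -ler_norml; apply: le_trans vM.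
have /mapP[j Hj ->] : `|v 0 i| \in [seq `|v x.1 x.2| | x : 'I_1 * 'I_n.+1].
  by apply/mapP; exists (0, i) => //=; rewrite mem_enum.
by rewrite [leRHS]/Num.norm /= mx_normrE; apply/bigmax_geP; right => /=; exists j.
Qed.

Lemma compact_closure_bounded Omega : bounded_set Omega -> compact (closure Omega).
Proof.
move=> /bounded_sub_cube[M hM].
have cK : compact (cbox (const_mx (- M)) (const_mx M) : set V) by exact: compact_cbox.
apply: (subclosed_compact _ cK); first exact: closed_closure.
have KE : cbox (const_mx (- M)) (const_mx M) = cube M :> set V.
  by apply/seteqP; split=> v h i; have := h i; rewrite !mxE.
rewrite KE; apply: subset_trans (closureS hM) _; rewrite -KE.
have := compact_closed _ cK => /(_ _) cC.
rewrite -(closure_id _).1//; apply: cC.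
exact: norm_hausdorff.
Qed.

Lemma within_continuous_bounded Omega (f : V -> R) : bounded_set Omega ->
  {within closure Omega, continuous f} ->
  exists2 M : R, 0 < M & forall x, closure Omega x -> `|f x| <= M.
Proof.
move=> bO cf; have cK := compact_closure_bounded bO.
have [M [Mr hM]] := compact_bounded (continuous_compact cf cK).
exists (`|M| + 1); first by rewrite ltr_wpDl.
move=> x cx; apply: (hM (`|M| + 1)); last by exists x.
by rewrite (le_lt_trans (ler_norm _))// ltrDl.
Qed.

Lemma lebesgue_bounded_lty Omega : bounded_set Omega -> measurable Omega ->
  (lebesgue_rV n.+1 Omega < +oo)%E.
Proof. by move=> /bounded_sub_cube[M hM] mO; exact: lebesgue_rV_subcube hM. Qed.

End domain.

(** * Least squares in weighted L^2 spaces *)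

Section weighted_L2.
Context d (X : measurableType d) (R : realType) (I : finType).
Variables (m : I -> {measure set X -> \bar R}) (D : I -> set X) (w : I -> X -> R).
Hypotheses (mD : forall i, measurable (D i))
  (mw : forall i, measurable_fun (D i) (w i))
  (w0 : forall i x, D i x -> 0 <= w i x).
Implicit Types (p q r s : I -> X -> R) (t : R).

Definition wL2 p := forall i, measurable_fun (D i) (p i) /\
  (m i).-integrable (D i) (fun x => (w i x * p i x ^+ 2)%:E).

Definition wnrm p : \bar R :=
  (\sum_i \int[m i]_(x in D i) (w i x * p i x ^+ 2)%:E)%E.

Definition wdot p q : R := \sum_i \int[m i]_(x in D i) (w i x * (p i x * q i x)).

(** One operation serves both for perturbations along [q] and, with [t = -1], for differences. *)
Definition comb p t q i x := p i x + t * q i x.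

Lemma comb_subK p q s : comb (comb p (-1) s) (-1) (comb q (-1) s) = comb p (-1) q.
Proof. by apply/funext => i; apply/funext => x; rewrite /comb; ring. Qed.

(** Dominated by means of |p q| <= p^2 + q^2. *)
Lemma wL2_cross p q i : wL2 p -> wL2 q ->
  (m i).-integrable (D i) (fun x => (w i x * (p i x * q i x))%:E).
Proof.
move=> /(_ i)[mp ip] /(_ i)[mq iq].
apply: (le_integrable _ _ _ (integrableD (mD i) ip iq)) => //.
  apply/measurable_EFinP; apply: measurable_funM => //.
  exact: measurable_funM.
move=> x Dx; rewrite -EFinD /= lee_fin -mulrDr ![`|w i x * _|]normrM.
rewrite ler_wpM2l// [leRHS]ger0_norm ?addr_ge0 ?sqr_ge0// normrM.
rewrite -(real_normK (num_real (p i x))) -(real_normK (num_real (q i x))).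
have := normr_ge0 (p i x); have := normr_ge0 (q i x).
by set a := `|p i x|; set b := `|q i x|; move=> b0 a0; nra.
Qed.

Lemma wL2_comb p t q : wL2 p -> wL2 q -> wL2 (comb p t q).
Proof.
move=> hp hq i; have [mp ip] := hp i; have [mq iq] := hq i; split.
  by apply: measurable_funD => //; apply: measurable_funM.
have ic := integrableZl (mD i) (2 * t) (wL2_cross i hp hq).
have iq' := integrableZl (mD i) (t ^+ 2) iq.
apply: eq_integrable (integrableD (mD i) (integrableD (mD i) ip ic) iq') => //.
by move=> x _; rewrite /= -!EFinM -!EFinD; congr EFin; rewrite /comb; ring.
Qed.

Lemma wdotC p q : wdot p q = wdot q p.
Proof.
apply: eq_bigr => i _; apply: eq_Rintegral => x _.
by rewrite [p i x * _]mulrC.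
Qed.

Lemma wdot_combl p t q s : wL2 p -> wL2 q -> wL2 s ->
  wdot (comb p t q) s = wdot p s + t * wdot q s.
Proof.
move=> hp hq hs; rewrite mulr_sumr -big_split; apply: eq_bigr => i _ /=.
have iq := wL2_cross i hq hs.
rewrite -RintegralZl// -RintegralD//.
- by apply: eq_Rintegral => x _; rewrite /comb; ring.
- exact: wL2_cross.
- by apply: eq_integrable (integrableZl (mD i) t iq) => // x _.
Qed.

Lemma wnrmE p : wL2 p -> wnrm p = (wdot p p)%:E.
Proof.
move=> hp; rewrite /wnrm /wdot -sumEFin; apply: eq_bigr => i _.
rewrite /Rintegral fineK; last first.
  by apply: integrable_fin_num => //; exact: wL2_cross.
by apply: eq_integral => x _; rewrite expr2.
Qed.

Lemma wdot_ge0 p : 0 <= wdot p p.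
Proof.
apply: sumr_ge0 => i _; apply: Rintegral_ge0 => x Dx.
by rewrite mulr_ge0 ?w0// -expr2 sqr_ge0.
Qed.

Lemma wnrm_comb p t q : wL2 p -> wL2 q -> wnrm (comb p t q) =
  (wdot p p + 2 * t * wdot p q + t ^+ 2 * wdot q q)%:E.
Proof.
move=> hp hq; have hpq := wL2_comb t hp hq.
rewrite wnrmE// wdot_combl// ![wdot _ (comb p t q)]wdotC !wdot_combl//.
by rewrite [wdot q p]wdotC; congr EFin; ring.
Qed.

Lemma wnrm_ae_eq p q : (forall i, measurable_fun (D i) (p i)) ->
  (forall i, measurable_fun (D i) (q i)) ->
  (forall i, {ae m i, forall x, D i x -> p i x = q i x}) -> wnrm p = wnrm q.
Proof.
move=> mp mq pq; apply: eq_bigr => i _; apply: ae_eq_integral => //.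
- apply/measurable_EFinP; apply: measurable_funM => //.
  exact: measurable_funX.
- apply/measurable_EFinP; apply: measurable_funM => //.
  exact: measurable_funX.
- by apply: filterS (pq i) => x h Dx; rewrite h.
Qed.

Lemma minimizer_wdot_eq0 r s : wL2 r -> wL2 s ->
  (forall t, wnrm r <= wnrm (comb r t s))%E -> wdot r s = 0.
Proof.
move=> hr hs h; set b := wdot r s; set c := wdot s s.
have c0 : 0 <= c by exact: wdot_ge0.
have {}h t : 0 <= 2 * t * b + t ^+ 2 * c.
  by have := h t; rewrite wnrm_comb// wnrmE// lee_fin -addrA lerDl.
have c1 : 0 < c + 1 by lra.
(* The quadratic is smallest at [- b / c]; the denominator [c + 1] admits [c = 0] and still gives a
   negative value unless [b = 0]. *)
have := h (- b / (c + 1)).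
rewrite (_ : _ + _ = - (b ^+ 2 * ((c + 2) / (c + 1) ^+ 2))); last first.
  by field; rewrite gt_eqF.
rewrite oppr_ge0 pmulr_lle0; last by rewrite divr_gt0 ?exprn_gt0//; lra.
by move=> b2; apply/eqP; rewrite -sqrf_eq0 eq_le b2 sqr_ge0.
Qed.

(** Being a difference of two vectors orthogonal to [s], [comb r (-1) r'] is orthogonal to [s], and
    subtracting [s] increases the squared norm by that of [s]. *)
Lemma wnrm_best_approximation r r' s : wL2 r -> wL2 r' -> wL2 s ->
  (forall t, wnrm r <= wnrm (comb r t s))%E ->
  (forall t, wnrm r' <= wnrm (comb r' t s))%E ->
  (wnrm (comb r (-1) r') <= wnrm (comb (comb r (-1) r') (-1) s))%E.
Proof.
move=> hr hr' hs h h'; have hrr' := wL2_comb (-1) hr hr'.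
rewrite (wnrm_comb _ hrr' hs) (wnrmE hrr') lee_fin (wdot_combl _ hr hr' hs).
rewrite (minimizer_wdot_eq0 hr hs h) (minimizer_wdot_eq0 hr' hs h').
by rewrite !mulr0 !addr0 mulr0 addr0 lerDl mulr_ge0 ?sqr_ge0// wdot_ge0.
Qed.

End weighted_L2.

(** * Square-integrable functions for a single measure *)

Section square_integrable.
Context d (X : measurableType d) (R : realType) (mu : {measure set X -> \bar R}).
Variables (D : set X) (mD : measurable D).
Implicit Types (p q h : X -> R) (t M : R).

Definition sq_integrable p :=
  measurable_fun D p /\ (\int[mu]_(x in D) (p x ^+ 2)%:E < +oo)%E.

Lemma sq_integrableP p : sq_integrable p <->
  measurable_fun D p /\ mu.-integrable D (fun x => (p x ^+ 2)%:E).
Proof.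
split=> -[mp hp]; split=> //; last first.
  move/integrableP: hp => [_]; apply: le_lt_trans; apply: ge0_le_integral => //.
  - by move=> x _; rewrite lee_fin sqr_ge0.
  - by apply/measurable_EFinP; exact: measurable_funX.
  - by apply/measurableT_comp => //; apply/measurable_EFinP; exact: measurable_funX.
  - by move=> x _; rewrite lee_fin ler_norm.
apply/integrableP; split; first by apply/measurable_EFinP; exact: measurable_funX.
by under eq_integral do rewrite gee0_abs ?lee_fin ?sqr_ge0//.
Qed.

Lemma le_sq_integrable p q t : 0 <= t -> measurable_fun D p -> sq_integrable q ->
  {ae mu, forall x, D x -> `|p x| <= t * `|q x|} -> sq_integrable p.
Proof.
move=> t0 mp [mq hq] pq; split=> //.
apply: (@le_lt_trans _ _ (\int[mu]_(x in D) ((t ^+ 2)%:E * (q x ^+ 2)%:E))%E).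
  apply: ae_ge0_le_integral => //.
  - by move=> x _; rewrite lee_fin sqr_ge0.
  - by apply/measurable_EFinP; exact: measurable_funX.
  - by move=> x _; rewrite -EFinM lee_fin mulr_ge0// sqr_ge0.
  - by apply: emeasurable_funM => //; apply/measurable_EFinP; exact: measurable_funX.
  apply: filterS pq => x /[apply] h; rewrite -EFinM lee_fin -exprMn.
  rewrite -real_normK ?num_real// -[leRHS]real_normK ?num_real//.
  by rewrite lerXn2r ?nnegrE// normrM (ger0_norm t0).
rewrite ge0_integralZl//.
- by apply: lte_mul_pinfty => //; rewrite lee_fin sqr_ge0.
- by apply/measurable_EFinP; exact: measurable_funX.
- by move=> x _; rewrite lee_fin sqr_ge0.
- by rewrite lee_fin sqr_ge0.
Qed.

Lemma sq_integrable_comb p t q : sq_integrable p -> sq_integrable q ->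
  sq_integrable (fun x => p x + t * q x).
Proof.
move=> /sq_integrableP[mp ip] /sq_integrableP[mq iq].
have W (r : X -> R) : measurable_fun D r -> mu.-integrable D (fun x => (r x ^+ 2)%:E) ->
    wL2 (fun _ : unit => mu) (fun=> D) (fun _ _ => 1) (fun=> r).
  by move=> mr ir _; split=> //; apply: eq_integrable ir => // x _; rewrite mul1r.
have := @wL2_comb _ _ _ unit _ _ _ (fun=> mD) (fun=> measurable_cst _)
  _ t _ (W _ mp ip) (W _ mq iq) tt.
move=> [m1 i1]; apply/sq_integrableP; split=> //.
by apply: eq_integrable i1 => // x _; rewrite mul1r.
Qed.

Lemma sq_integrable_cst : (mu D < +oo)%E -> sq_integrable (cst 1).
Proof.
move=> Doo; split; first exact: measurable_cst.
by rewrite /= expr1n integral_cst// mul1e.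
Qed.

(** On a set of finite measure, [M (1 + p^2)] is an integrable majorant. *)
Lemma sq_integrable_mul p h M : (mu D < +oo)%E -> sq_integrable p ->
  measurable_fun D h -> (forall x, D x -> `|h x| <= M) ->
  mu.-integrable D (EFin \o (fun x => p x * h x)).
Proof.
move=> Doo /sq_integrableP[mp ip] mh hM.
have i1 := (sq_integrableP _).1 (sq_integrable_cst Doo).
have ig := integrableZl mD M (integrableD mD i1.2 ip).
apply: le_integrable ig => //; first by apply/measurable_EFinP; exact: measurable_funM.
move=> x Dx; rewrite /= lee_fin expr1n normrM.
have M0 : 0 <= M by apply: le_trans (hM x Dx).
rewrite [leRHS]ger0_norm; last by rewrite mulr_ge0// addr_ge0// sqr_ge0.
rewrite mulrC ler_pM//; first exact: hM.
rewrite -(real_normK (num_real (p x))); have := normr_ge0 (p x).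
by set a := `|p x|; nra.
Qed.

End square_integrable.

(** * Weak divergence and normal trace *)

Section weak_divergence.
Context {R : realType} {n : nat}.
Local Notation V := 'rV[R]_n.+1.
Local Notation mu := (lebesgue_rV n.+1).
Variables (Omega : set V) (oO : open Omega) (bO : bounded_set Omega).
Implicit Types (tau : V -> V) (v w phi : V -> R).

Let mO : measurable Omega. Proof. exact: open_measurable_rV. Qed.

Let muO : (mu Omega < +oo)%E. Proof. exact: lebesgue_bounded_lty. Qed.

Lemma continuous_bounded phi : continuous phi ->
  exists2 M : R, 0 < M & forall x, closure Omega x -> `|phi x| <= M.
Proof.
by move=> cphi; apply: within_continuous_bounded => //; exact: continuous_subspaceT.
Qed.

Lemma smooth_continuous phi : smooth phi -> continuous phi.
Proof. by move=> /(_ 0%N) []. Qed.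

Lemma smooth_pderiv_continuous phi j : smooth phi -> continuous (pderiv phi j).
Proof. by move=> /(_ 1%N) [_ /(_ j)[_ []]]. Qed.

Lemma integrable_L2_continuous v phi : L2 Omega v -> continuous phi ->
  mu.-integrable Omega (EFin \o (fun x => v x * phi x)).
Proof.
move=> hv cphi; have [M _ hM] := continuous_bounded cphi.
apply: (@sq_integrable_mul _ _ _ _ _ _ _ _ M) => //.
  exact: continuous_measurable_rV.
by move=> x Ox; apply: hM; exact: subset_closure.
Qed.

Lemma integrable_L2 v : L2 Omega v -> mu.-integrable Omega (EFin \o v).
Proof.
move=> hv; have := @integrable_L2_continuous v (fun=> 1) hv (@continuous_rV_cst _ _ 1).
by apply: eq_integrable => // x _; rewrite /= mulr1.
Qed.

Lemma integrable_dotv_grad tau phi : L2_vec Omega tau -> smooth phi ->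
  mu.-integrable Omega (EFin \o (fun x => dotv (tau x) (grad phi x))).
Proof.
move=> htau sphi.
have -> : EFin \o (fun x => dotv (tau x) (grad phi x)) =
    (fun x => \sum_(j <- index_enum 'I_n.+1) (tau x 0 j * pderiv phi j x)%:E)%E.
  apply/funext => x; rewrite /= sumEFin; congr EFin.
  by apply: eq_bigr => j _; rewrite mxE.
apply: integrable_sum => // j _.
exact: (integrable_L2_continuous (htau j) (@smooth_pderiv_continuous phi j sphi)).
Qed.

Lemma L2_comb v t w : L2 Omega v -> L2 Omega w -> L2 Omega (fun x => v x + t * w x).
Proof. exact: sq_integrable_comb. Qed.

Lemma L2_vec_comb tau t tau' : L2_vec Omega tau -> L2_vec Omega tau' ->
  L2_vec Omega (fun x => tau x + t *: tau' x).
Proof.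
move=> h h' j; have := L2_comb t (h j) (h' j); congr L2.
by apply/funext => x; rewrite !mxE.
Qed.

Lemma is_weak_div_comb tau w t tau' w' : L2_vec Omega tau -> L2_vec Omega tau' ->
  is_weak_div Omega tau w -> is_weak_div Omega tau' w' ->
  is_weak_div Omega (fun x => tau x + t *: tau' x) (fun x => w x + t * w' x).
Proof.
move=> ht ht' [hw hd] [hw' hd']; split; first exact: L2_comb.
move=> phi tphi; have sphi := tphi.1; have cphi := smooth_continuous sphi.
have i1 := integrable_dotv_grad ht sphi; have i2 := integrable_dotv_grad ht' sphi.
have i3 := integrable_L2_continuous hw cphi; have i4 := integrable_L2_continuous hw' cphi.
rewrite (@eq_Rintegral _ _ _ _ _ (fun x => dotv (tau x) (grad phi x) +
  t * dotv (tau' x) (grad phi x))); last by move=> x _; rewrite dotvDl dotvZl.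
rewrite [in RHS](@eq_Rintegral _ _ _ _ _
  (fun x => w x * phi x + t * (w' x * phi x))); last first.
  by move=> x _; rewrite mulrDl mulrA.
rewrite !RintegralD// ?RintegralZl//.
- by rewrite hd// hd'// mulrN opprD.
- by apply: eq_integrable (integrableZl mO t i4) => // x _.
- by apply: eq_integrable (integrableZl mO t i2) => // x _.
Qed.

(** The difference is orthogonal to the bumps of all closed boxes inside [Omega]; the family of
    measures is here the single Lebesgue measure. *)
Lemma is_weak_div_unique tau w w' : is_weak_div Omega tau w ->
  is_weak_div Omega tau w' -> {ae mu, forall x, Omega x -> w x = w' x}.
Proof.
move=> [hw hd] [hw' hd'].
have hz := L2_comb (-1) hw hw'.
have := @ae_eq0_bump R n unit xpredT (fun=> mu) Omega (fun x => w x + -1 * w' x) mO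
  (fun _ _ => integrable_L2 hz) Omega oO.
move=> /(_ _ tt isT) h.
have {h} : {ae mu, forall x, Omega x -> Omega x -> w x + -1 * w' x = 0}.
  apply: h => a b k abO; rewrite big_const card_unit /= addr0.
  have tb : test_function Omega (box_bump k a b) by exact: test_function_box_bump.
  have cphi := smooth_continuous tb.1.
  have i3 := integrable_L2_continuous hw cphi.
  have i4 := integrable_L2_continuous hw' cphi.
  rewrite (@eq_Rintegral _ _ _ _ _
    (fun x => w x * box_bump k a b x - w' x * box_bump k a b x)).
    rewrite RintegralB//; apply/eqP; rewrite subr_eq0 -eqr_opp.
    by rewrite -(hd _ tb) -(hd' _ tb).
  by move=> x _; rewrite mulN1r mulrBl.
apply: filterS => x h Ox; apply/eqP; rewrite -subr_eq0 -mulN1r.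
by apply/eqP; exact: h.
Qed.

Lemma wdivP tau : Hdiv Omega tau -> is_weak_div Omega tau (wdiv Omega tau).
Proof. by move=> [_ ex]; exact: (@xgetPex _ (cst 0) (is_weak_div Omega tau)). Qed.

Lemma Hdiv_comb tau t tau' : Hdiv Omega tau -> Hdiv Omega tau' ->
  Hdiv Omega (fun x => tau x + t *: tau' x).
Proof.
move=> h h'; split; first by apply: L2_vec_comb; [exact: h.1|exact: h'.1].
by exists (fun x => wdiv Omega tau x + t * wdiv Omega tau' x);
  apply: is_weak_div_comb; [exact: h.1|exact: h'.1|exact: wdivP|exact: wdivP].
Qed.

Lemma wdiv_comb tau t tau' : Hdiv Omega tau -> Hdiv Omega tau' ->
  {ae mu, forall x, Omega x -> wdiv Omega (fun x => tau x + t *: tau' x) x =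
                               wdiv Omega tau x + t * wdiv Omega tau' x}.
Proof.
move=> h h'; apply: is_weak_div_unique; first exact/wdivP/Hdiv_comb.
by apply: is_weak_div_comb; [exact: h.1|exact: h'.1|exact: wdivP|exact: wdivP].
Qed.

Lemma L2_0 : L2 Omega (cst 0).
Proof.
split; first exact: measurable_cst.
rewrite /nrm2 (_ : (fun _ => _) = cst 0%E) ?integral0//.
by apply/funext => x; rewrite expr0n.
Qed.

Lemma is_weak_div0 : is_weak_div Omega (cst 0) (cst 0).
Proof.
split; first exact: L2_0.
move=> phi _.
rewrite (@eq_Rintegral _ _ _ _ _ (cst 0)); last by move=> x _; rewrite dotv0l.
rewrite [in RHS](@eq_Rintegral _ _ _ _ _ (cst 0)); last by move=> x _; rewrite mul0r.
by rewrite Rintegral_cst// mul0r oppr0.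
Qed.

Lemma Hdiv0 : Hdiv Omega (cst 0).
Proof.
split; last by exists (cst 0); exact: is_weak_div0.
by move=> j; have := L2_0; congr L2; apply/funext => x; rewrite mxE.
Qed.

End weak_divergence.

(** * Normal traces on the inflow boundary *)

Section normal_trace.
Context {R : realType} {n : nat}.
Local Notation V := 'rV[R]_n.+1.
Local Notation mu := (lebesgue_rV n.+1).
Variables (Omega : set V) (beta : V -> V) (T : mesh R n).
Hypotheses (oO : open Omega) (bO : bounded_set Omega)
  (cb : {within closure Omega, continuous beta}).
Implicit Types (tau : V -> V) (v w q phi : V -> R) (F : facet T).

Local Notation Gamma := (inflow Omega beta).
Local Notation inF F := (inflow_facet Omega beta F).

Let mO : measurable Omega. Proof. exact: open_measurable_rV. Qed.

Let mG : measurable Gamma. Proof. exact: measurable_inflow. Qed.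

Let G_closure : Gamma `<=` closure Omega. Proof. by move=> x [[]]. Qed.

Lemma L2_inflowP q : L2_inflow Omega beta T q <-> measurable_fun Gamma q /\
  forall F, inF F -> sq_integrable (surf F) Gamma q.
Proof.
split=> -[mq hq]; split=> //.
  move=> F iF; split=> //; apply: le_lt_trans hq.
  rewrite (bigD1 F)//= leeDl// sume_ge0// => F' _.
  by apply: integral_ge0 => x _; rewrite lee_fin sqr_ge0.
by apply: lte_sum_pinfty => F iF; exact: (hq F iF).2.
Qed.

Lemma L2_inflow_comb q t q' : L2_inflow Omega beta T q ->
  L2_inflow Omega beta T q' -> L2_inflow Omega beta T (fun x => q x + t * q' x).
Proof.
move=> /L2_inflowP[mq hq] /L2_inflowP[mq' hq']; apply/L2_inflowP; split.
  by apply: measurable_funD => //; exact: measurable_funM.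
by move=> F iF; apply: sq_integrable_comb; [exact: mG|exact: hq|exact: hq'].
Qed.

Lemma integrable_inflow q phi F : L2_inflow Omega beta T q -> continuous phi ->
  inF F -> (surf F).-integrable Gamma (EFin \o (fun x => q x * phi x)).
Proof.
move=> /L2_inflowP[mq hq] cphi iF; have [M _ hM] := continuous_bounded bO cphi.
apply: (@sq_integrable_mul _ _ _ _ _ _ _ _ M) => //.
- exact: surf_lty.
- exact: hq.
- exact: continuous_measurable_rV.
- by move=> x Gx; apply: hM; exact: G_closure.
Qed.

Lemma ntraceP tau : has_normal_trace Omega beta T tau ->
  is_normal_trace Omega beta T tau (ntrace Omega beta T tau).
Proof. by move=> ex; exact: (@xgetPex _ (cst 0) (is_normal_trace Omega beta T tau)). Qed.

Lemma integrable_green tau phi : Hdiv Omega tau -> smooth phi ->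
  mu.-integrable Omega (EFin \o (fun x =>
    dotv (tau x) (grad phi x) + wdiv Omega tau x * phi x)).
Proof.
move=> htau sphi; have cphi := smooth_continuous sphi.
have i1 := integrable_dotv_grad oO bO htau.1 sphi.
have i2 := integrable_L2_continuous oO bO (wdivP htau).1 cphi.
by apply: eq_integrable (integrableD mO i1 i2) => // x _.
Qed.

Lemma is_normal_trace_comb tau t tau' q q' : Hdiv Omega tau -> Hdiv Omega tau' ->
  is_normal_trace Omega beta T tau q ->
  is_normal_trace Omega beta T tau' q' ->
  is_normal_trace Omega beta T (fun x => tau x + t *: tau' x)
    (fun x => q x + t * q' x).
Proof.
move=> ht ht' [hq hd] [hq' hd']; split; first exact: L2_inflow_comb.
move=> phi sphi phi0; have cphi := smooth_continuous sphi.
have i1 := integrable_green ht sphi; have i2 := integrable_green ht' sphi.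
have i3 := integrable_green (Hdiv_comb oO bO t ht ht') sphi.
(* Green's formula involves the divergence chosen for the combined flux; it is exchanged, off a null
   set, for the combination of the two chosen divergences. *)
transitivity (\int[mu]_(x in Omega)
  ((dotv (tau x) (grad phi x) + wdiv Omega tau x * phi x) +
   t * (dotv (tau' x) (grad phi x) + wdiv Omega tau' x * phi x))).
  apply: ae_eq_Rintegral => //.
  - by apply/measurable_EFinP; exact: measurable_int i3.
  - apply: measurable_funD; first by apply/measurable_EFinP; exact: measurable_int i1.
    by apply: measurable_funM => //; apply/measurable_EFinP; exact: measurable_int i2.
  - apply: filterS (wdiv_comb oO bO t ht ht') => x h Ox.
    by rewrite h// dotvDl dotvZl; ring.
rewrite RintegralD//; last by apply: eq_integrable (integrableZl mO t i2) => // x _.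
rewrite RintegralZl// hd// hd'// mulr_sumr -big_split; apply: eq_bigr => F iF /=.
have j1 := integrable_inflow hq cphi iF; have j2 := integrable_inflow hq' cphi iF.
rewrite [RHS](@eq_Rintegral _ _ _ _ _ (fun x => q x * phi x + t * (q' x * phi x))).
  rewrite RintegralD//; last by apply: eq_integrable (integrableZl mG t j2) => // x _.
  by rewrite RintegralZl.
by move=> x _; rewrite mulrDl mulrA.
Qed.

(** Both traces share the left-hand side of Green's formula, so their difference has zero sum of
    integrals against every admissible bump. All inflow facets are handled at once, for a bump may
    meet several of them. *)
Lemma is_normal_trace_unique tau q q' :
  is_normal_trace Omega beta T tau q ->
  is_normal_trace Omega beta T tau q' ->
  forall F, inF F -> {ae surf F, forall x, Gamma x -> q x = q' x}.
Proof.
move=> [hq hd] [hq' hd'] F iF.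
have [W oW WE] := betan_lt_open cb (lexx 0).
have GW x : Gamma x -> W x by rewrite /inflow WE => -[].
have hz := L2_inflow_comb (-1) hq hq'.
have iz F' : inF F' -> (surf F').-integrable Gamma (EFin \o (fun x => q x + -1 * q' x)).
  move=> iF'.
  have := integrable_inflow hz (@continuous_rV_cst _ _ 1) iF'.
  by apply: eq_integrable => // x _; rewrite /= mulr1.
have h := @ae_eq0_bump R n (facet T) (fun F' => inF F') (@surf R n T) Gamma
  (fun x => q x + -1 * q' x) mG iz W oW.
have {h} : {ae surf F, forall x, Gamma x -> W x -> q x + -1 * q' x = 0}.
  apply: h iF => a b k abW.
  have sphi := @smooth_box_bump R n k a b; have cphi := smooth_continuous sphi.
  have phi0 F' : boundary_facet Omega F' ->
      {ae surf F', forall x, ~ Gamma x -> box_bump k a b x = 0}.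
    (* Almost every point of the facet lies on the boundary of [Omega]; off [Gamma] it is then
       outside [W], hence outside the box. *)
    move=> bF'; apply: filterS (ae_surf (measurable_bdry Omega) bF') => x bx nGx.
    apply: box_bump_out => /abW Wx; apply: nGx.
    by rewrite /inflow WE.
  rewrite (eq_bigr (fun F' => \int[surf F']_(x in Gamma) (q x * box_bump k a b x) -
                              \int[surf F']_(x in Gamma) (q' x * box_bump k a b x))).
    by rewrite sumrB -hd// -hd'// subrr.
  move=> F' iF'; rewrite -RintegralB//; try exact: integrable_inflow.
  by apply: eq_Rintegral => x _; rewrite mulN1r mulrBl.
apply: filterS => x h Gx; apply/eqP; rewrite -subr_eq0 -mulN1r.
by apply/eqP; apply: h => //; exact: GW.
Qed.

Lemma Sigma_comb tau t tau' : Sigma Omega beta T tau -> Sigma Omega beta T tau' ->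
  Sigma Omega beta T (fun x => tau x + t *: tau' x).
Proof.
move=> [h /ntraceP hq] [h' /ntraceP hq']; split; first exact: Hdiv_comb.
by exists (fun x => ntrace Omega beta T tau x + t * ntrace Omega beta T tau' x);
  exact: is_normal_trace_comb.
Qed.

Lemma ntrace_comb tau t tau' F : Sigma Omega beta T tau -> Sigma Omega beta T tau' ->
  inF F -> {ae surf F, forall x, Gamma x ->
    ntrace Omega beta T (fun x => tau x + t *: tau' x) x =
    ntrace Omega beta T tau x + t * ntrace Omega beta T tau' x}.
Proof.
move=> h h' iF; apply: is_normal_trace_unique iF.
  by apply: ntraceP; exact: (Sigma_comb t h h').2.
by apply: is_normal_trace_comb; [exact: h.1|exact: h'.1|
  exact: (ntraceP h.2)|exact: (ntraceP h'.2)].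
Qed.

Lemma Sigma0 : Sigma Omega beta T (cst 0).
Proof.
split; first exact: Hdiv0.
exists (cst 0); split.
  apply/L2_inflowP; split; first exact: measurable_cst.
  move=> F iF; split; first exact: measurable_cst.
  rewrite (_ : (fun _ => _) = cst 0%E) ?integral0//.
  by apply/funext => x; rewrite expr0n.
move=> phi sphi _; have i := integrable_green (Hdiv0 oO) sphi.
rewrite big1 => [|F iF]; last first.
  rewrite (@eq_Rintegral _ _ _ _ _ (cst 0)); last by move=> x _; rewrite mul0r.
  by rewrite Rintegral_cst// mul0r.
rewrite (@ae_eq_Rintegral _ _ _ mu Omega _ (cst 0)).
- by rewrite Rintegral_cst// mul0r.
- exact: mO.
- by apply/measurable_EFinP; exact: measurable_int i.
- exact: measurable_cst.
(* The divergence chosen for the zero flux is known to be zero only almost everywhere. *)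
have := is_weak_div_unique oO bO (wdivP (Hdiv0 oO)) (is_weak_div0 oO).
by apply: filterS => x h Ox; rewrite h// dotv0l add0r mul0r.
Qed.

End normal_trace.

(** * The least-squares functional *)

Section discrete_spaces.
Context {R : realType} {n : nat}.
Local Notation V := 'rV[R]_n.+1.
Variables (Omega : set V) (oO : open Omega) (bO : bounded_set Omega) (T : mesh R n).
Implicit Types (tau : V -> V) (v : V -> R).

Lemma polynomial_le_comb k t (p q : mpoly.mpoly n.+1 R) : polynomial_le k p ->
  polynomial_le k q -> polynomial_le k (p + t *: q).
Proof.
move=> hp hq; apply: leq_trans (mpoly.msizeD_le _ _) _; rewrite geq_max.
by apply/andP; split=> //; exact: leq_trans (mpoly.msizeZ_le _ _) hq.
Qed.

Lemma polynomial_le0 k : polynomial_le k (0 : mpoly.mpoly n.+1 R).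
Proof. by rewrite /polynomial_le mpoly.msize0. Qed.

Lemma RT_comb k tau t tau' : RT Omega T k tau -> RT Omega T k tau' ->
  RT Omega T k (fun x => tau x + t *: tau' x).
Proof.
move=> [h hK] [h' hK']; split; first exact: Hdiv_comb.
move=> K; have [p [q [hp hq e]]] := hK K; have [p' [q' [hp' hq' e']]] := hK' K.
exists (fun j => p j + t *: p' j), (q + t *: q'); split.
- by move=> j; exact: polynomial_le_comb.
- exact: polynomial_le_comb.
apply: filterS2 e e' => x hx hx' Kx; rewrite hx// hx'//.
by apply/rowP => j; rewrite !mxE !mpoly.mevalD !mpoly.mevalZ; ring.
Qed.

Lemma Pk_comb k v t v' : Pk Omega T k v -> Pk Omega T k v' ->
  Pk Omega T k (fun x => v x + t * v' x).
Proof.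
move=> [h hK] [h' hK']; split; first exact: L2_comb.
move=> K; have [p hp e] := hK K; have [p' hp' e'] := hK' K.
exists (p + t *: p'); first exact: polynomial_le_comb.
apply: filterS2 e e' => x hx hx' Kx; rewrite hx// hx'//.
by rewrite mpoly.mevalD mpoly.mevalZ.
Qed.

Lemma RT0 k : RT Omega T k (cst 0).
Proof.
split=> [|K]; first exact: Hdiv0.
exists (fun=> 0), 0; split; [by move=> j; exact: polynomial_le0|exact: polynomial_le0|].
apply: aeW => x _; apply/rowP => j.
by rewrite !mxE !mpoly.meval0 mul0r addr0.
Qed.

Lemma Pk0 k : Pk Omega T k (cst 0).
Proof.
split=> [|K]; first exact: L2_0.
by exists 0; [exact: polynomial_le0|apply: aeW => x _; rewrite mpoly.meval0].
Qed.

End discrete_spaces.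

(** * The residual as an element of a weighted L^2 space *)

Section least_squares_norm.
Context {R : realType} {n : nat}.
Local Notation V := 'rV[R]_n.+1.
Local Notation mu := (lebesgue_rV n.+1).
Variables (Omega : set V) (beta : V -> V) (gamma f g : V -> R) (c : R)
  (T : mesh R n) (omega : facet T -> R).
Local Notation Gamma := (inflow Omega beta).
Local Notation bn := (betan Omega beta).
Hypotheses (oO : open Omega) (bO : bounded_set Omega)
  (cb : {within closure Omega, continuous beta}) (hgamma : Linfty Omega gamma)
  (c0 : 0 < c) (hc : forall x, Gamma x -> c <= `|bn x|)
  (hf : L2 Omega f) (mg : measurable_fun Gamma g)
  (hg : (\sum_(F : facet T | inflow_facet Omega beta F)
       \int[surf F]_(x in Gamma) (`|bn x| * g x ^+ 2)%:E < +oo)%E)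
  (omega0 : forall F, 0 <= omega F).
Implicit Types (tau : V -> V) (v : V -> R) (U : (V -> V) * (V -> R)).

Let mO : measurable Omega. Proof. exact: open_measurable_rV. Qed.

Let mG : measurable Gamma. Proof. exact: measurable_inflow. Qed.

(* [Some j] indexes the j-th component of the flux residual, [None] the
   balance residual and the facets the inflow residual. *)
Definition ls_index : finType := (option 'I_n.+1 + facet T)%type.

Definition ls_measure (i : ls_index) : {measure set V -> \bar R} :=
  match i with inl _ => mu | inr F => surf F end.

(** The empty domain removes the other facets from sums over the whole index type. *)
Definition ls_domain (i : ls_index) : set V :=
  match i with
  | inl _ => Omega
  | inr F => if inflow_facet Omega beta F then Gamma else set0
  end.

Definition ls_weight (i : ls_index) (x : V) : R :=
  match i with inl _ => 1 | inr F => omega F / `|bn x| end.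

(** The linear part of the residual: [LS] measures its distance to [ls_data], and [normB] its own
    norm. *)
Definition ls_image U (i : ls_index) (x : V) : R :=
  match i with
  | inl (Some j) => U.1 x 0 j - U.2 x * beta x 0 j
  | inl None => wdiv Omega U.1 x + gamma x * U.2 x
  | inr F => ntrace Omega beta T U.1 x
  end.

Definition ls_data (i : ls_index) (x : V) : R :=
  match i with
  | inl (Some j) => 0
  | inl None => f x
  | inr F => bn x * g x
  end.

Definition admissible U := Sigma Omega beta T U.1 /\ L2 Omega U.2.

Local Notation wL2 := (wL2 ls_measure ls_domain ls_weight).
Local Notation wnrm := (wnrm ls_measure ls_domain ls_weight).

Lemma measurable_ls_domain i : measurable (ls_domain i).
Proof. by case: i => [i|F] //=; case: ifP. Qed.

Lemma measurable_ls_weight i : measurable_fun (ls_domain i) (ls_weight i).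
Proof.
case: i => [i|F] /=; first exact: measurable_cst.
case: ifP => _; last exact: measurable_fun_set0.
rewrite (_ : ls_weight (inr F) = (fun x => omega F * `|bn x| `^ (-1))); last first.
  by apply/funext => x; rewrite powR_inv1.
apply: measurable_funM; first exact: measurable_cst.
apply: (measurableT_comp (measurable_powR _)); apply: measurableT_comp => //.
exact: measurable_fun_betan.
Qed.

Lemma ls_weight_ge0 i x : ls_domain i x -> 0 <= ls_weight i x.
Proof. by case: i => [i|F] //= _; rewrite divr_ge0. Qed.

Let bn_gt0 x : Gamma x -> 0 < `|bn x|.
Proof. by move=> /hc; exact: lt_le_trans. Qed.

Lemma wL2_volume (o : option 'I_n.+1) (p : V -> R) : L2 Omega p ->
  measurable_fun (ls_domain (inl o)) p /\
  (ls_measure (inl o)).-integrable (ls_domain (inl o))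
    (fun x => (ls_weight (inl o) x * p x ^+ 2)%:E).
Proof.
move=> /sq_integrableP[//|mp ip]; split=> //.
by apply: eq_integrable ip => // x _; rewrite mul1r.
Qed.

Lemma beta_bounded j : exists2 M : R, 0 < M &
  forall x, closure Omega x -> `|beta x 0 j| <= M.
Proof.
by apply: within_continuous_bounded => //; exact: within_continuous_coord.
Qed.

(** [beta] is bounded on the compact closure of [Omega], [gamma] is essentially bounded, and the
    weight on a facet is at most [omega F / c]. *)
Lemma wL2_image U : admissible U -> wL2 (ls_image U).
Proof.
move=> [[hd ht] hv] [[j|]|F].
- apply: wL2_volume.
  have [M M0 hM] := beta_bounded j.
  have mb : measurable_fun Omega (fun x => beta x 0 j).
    by apply: measurable_fun_within => //; exact: within_continuous_coord.
  have hb : L2 Omega (fun x => U.2 x * beta x 0 j).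
    apply: (@le_sq_integrable _ _ _ _ _ mO _ U.2 M) => //.
    + exact: ltW.
    + by apply: measurable_funM => //; exact: hv.1.
    + apply: aeW => x Ox; rewrite normrM mulrC ler_wpM2r//.
      by apply: hM; exact: subset_closure.
  have := L2_comb oO (-1) (hd.1 j) hb; congr L2.
  by apply/funext => x; rewrite mulN1r.
- apply: wL2_volume.
  have [mgam [M hM]] := hgamma.
  have hb : L2 Omega (fun x => gamma x * U.2 x).
    apply: (@le_sq_integrable _ _ _ _ _ mO _ U.2 `|M|) => //.
    + by apply: measurable_funM => //; exact: hv.1.
    + apply: filterS hM => x h Ox; rewrite normrM ler_wpM2r//.
      by rewrite (le_trans (h Ox))// ler_norm.
  have := L2_comb oO 1 (wdivP hd).1 hb; congr L2.
  by apply/funext => x; rewrite mul1r.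
rewrite /= ; case: ifPn => iF; last first.
  by split; [exact: measurable_fun_set0|exact: integrable_set0].
have [mq hq] := (L2_inflowP _ _ _ _).1 (ntraceP ht).1.
split=> //; have /sq_integrableP[//|_ iq] := hq F iF.
apply: (le_integrable _ _ _ (integrableZl mG (omega F / c) iq)) => //.
  apply/measurable_EFinP; apply: measurable_funM; last exact: measurable_funX.
  by have := @measurable_ls_weight (inr F); rewrite /= iF.
move=> x Gx; rewrite /= lee_fin !normrM ler_wpM2r// ler_wpM2l//.
rewrite !normfV normr_id (gtr0_norm c0) lef_pV2 ?posrE ?bn_gt0//.
exact: hc.
Qed.

(** The weight cancels one factor of the inflow datum: (omega / |bn|) (bn g)^2 = omega |bn| g^2,
    which is integrable by the assumption on [g]. *)
Lemma wL2_data : wL2 ls_data.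
Proof.
move=> [[j|]|F].
- by apply: wL2_volume; exact: L2_0.
- exact: wL2_volume.
rewrite /=; case: ifPn => iF; last first.
  by split; [exact: measurable_fun_set0|exact: integrable_set0].
have mbn := measurable_fun_betan cb.
split; first exact: measurable_funM.
have mw := @measurable_ls_weight (inr F); rewrite /= iF in mw.
have mb2 : measurable_fun Gamma (fun x => `|bn x| * g x ^+ 2).
  apply: measurable_funM; last exact: measurable_funX.
  exact: measurableT_comp.
have ig : (surf F).-integrable Gamma (fun x => (`|bn x| * g x ^+ 2)%:E).
  apply/integrableP; split; first exact/measurable_EFinP.
  rewrite (eq_integral (fun x => (`|bn x| * g x ^+ 2)%:E)); last first.
    by move=> x _; rewrite gee0_abs// lee_fin mulr_ge0// sqr_ge0.
  apply: le_lt_trans hg; rewrite (bigD1 F)//= leeDl// sume_ge0// => F' _.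
  by apply: integral_ge0 => x _; rewrite lee_fin mulr_ge0// sqr_ge0.
apply: eq_integrable (integrableZl mG (omega F) ig) => //.
move=> x; rewrite inE => Gx; rewrite -EFinM; congr EFin.
rewrite exprMn -[bn x ^+ 2]real_normK ?num_real//.
by field; rewrite gt_eqF// bn_gt0.
Qed.

Lemma ls_sumE (h : ls_index -> V -> R) :
  (forall i, measurable_fun (ls_domain i) (h i)) ->
  wnrm h = (\int[mu]_(x in Omega) (\sum_j h (inl (Some j)) x ^+ 2)%:E +
    nrm2 Omega (h (inl None)) +
    \sum_(F : facet T | inflow_facet Omega beta F)
      \int[surf F]_(x in Gamma) (omega F / `|bn x| * h (inr F) x ^+ 2)%:E)%E.
Proof.
move=> mh; rewrite /wnrm big_sumType /= (bigD1 None)//=.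
rewrite (reindex_omap Some id); last by case.
congr (_ + _)%E.
  rewrite addeC; congr (_ + _)%E.
    rewrite (eq_bigl xpredT); last by move=> j; rewrite /= eqxx.
    under [RHS]eq_integral do rewrite -sumEFin.
    rewrite ge0_integral_sum//.
    - apply: eq_bigr => j _; apply: eq_integral => x _.
      by rewrite mul1r.
    - move=> j; apply/measurable_EFinP; apply: measurable_funX.
      exact: (mh (inl (Some j))).
    - by move=> j x _; rewrite lee_fin sqr_ge0.
  by apply: eq_integral => x _; rewrite mul1r.
rewrite [RHS]big_mkcond; apply: eq_bigr => F _ /=.
by case: ifP => // _; rewrite integral_set0.
Qed.

Let wL2_measurable h : wL2 h -> forall i, measurable_fun (ls_domain i) (h i).
Proof. by move=> hh i; exact: (hh i).1. Qed.

Let mD := measurable_ls_domain.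
Let mw := measurable_ls_weight.

Lemma LSE U : admissible U ->
  LS Omega beta gamma omega f g U = wnrm (comb (ls_image U) (-1) ls_data).
Proof.
move=> aU; have [[hd ht] hv] := aU.
rewrite ls_sumE; last first.
  apply: wL2_measurable; apply: wL2_comb => //; first exact: wL2_image.
  exact: wL2_data.
rewrite /LS /trace_nrm2; case: asboolP => // _.
congr (_ + _ + _)%E.
- apply: eq_integral => x _; congr EFin; apply: eq_bigr => j _.
  by rewrite /comb /= !mxE mulr0 addr0 expr2.
- by apply: eq_integral => x _; rewrite /comb /= mulN1r.
- by apply: eq_bigr => F _; apply: eq_integral => x _; rewrite /comb /= mulN1r.
Qed.

Lemma normBE U : admissible U ->
  normB Omega beta gamma omega U.1 U.2 = (wnrm (ls_image U) `^ 2^-1)%E.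
Proof.
move=> aU; have [[hd ht] hv] := aU.
rewrite ls_sumE; last by apply: wL2_measurable; exact: wL2_image.
rewrite /normB /trace_nrm2; case: asboolP => // _.
congr ((_ + _ + _) `^ _)%E.
- apply: eq_integral => x _; congr EFin; apply: eq_bigr => j _.
  by rewrite /= !mxE expr2.
- by apply: eq_bigr => F _; apply: eq_integral => x _; rewrite subr0.
Qed.

Definition pair_comb U t U' : (V -> V) * (V -> R) :=
  (fun x => U.1 x + t *: U'.1 x, fun x => U.2 x + t * U'.2 x).

Lemma admissible_comb U t U' : admissible U -> admissible U' ->
  admissible (pair_comb U t U').
Proof.
by move=> [h1 h2] [h1' h2']; split; [exact: Sigma_comb|exact: L2_comb].
Qed.

Lemma ls_image_comb U t U' : admissible U -> admissible U' -> forall i,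
  {ae ls_measure i, forall x, ls_domain i x ->
    ls_image (pair_comb U t U') i x = comb (ls_image U) t (ls_image U') i x}.
Proof.
move=> [h1 h2] [h1' h2'] [[j|]|F] /=.
- by apply: aeW => x _; rewrite /comb /= !mxE; ring.
- apply: filterS (wdiv_comb oO bO t h1.1 h1'.1) => x h Ox.
  by rewrite h// /comb /=; ring.
- case: ifPn => iF; last by apply: aeW.
  by apply: filterS (ntrace_comb oO bO cb t h1 h1' iF) => x h Gx; exact: h.
Qed.

Lemma LS_comb U t U' : admissible U -> admissible U' ->
  LS Omega beta gamma omega f g (pair_comb U t U') =
  wnrm (comb (comb (ls_image U) (-1) ls_data) t (ls_image U')).
Proof.
move=> h h'; rewrite LSE; last exact: admissible_comb.
apply: wnrm_ae_eq => //.
- apply: wL2_measurable; apply: (wL2_comb mD mw); last exact: wL2_data.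
  by apply: wL2_image; exact: admissible_comb.
- apply: wL2_measurable; apply: (wL2_comb mD mw); last exact: wL2_image.
  by apply: (wL2_comb mD mw); [exact: wL2_image|exact: wL2_data].
- move=> i; apply: filterS (ls_image_comb t h h' i) => x hx Dx.
  by rewrite [LHS]/comb hx// /comb addrAC.
Qed.

Lemma LS_lty U : admissible U -> (LS Omega beta gamma omega f g U < +oo)%E.
Proof.
move=> h; rewrite LSE// wnrmE ?ltry//.
by apply: (wL2_comb mD mw); [exact: wL2_image|exact: wL2_data].
Qed.

Lemma LS_no_trace U : ~ has_normal_trace Omega beta T U.1 ->
  LS Omega beta gamma omega f g U = +oo%E.
Proof.
move=> nt; rewrite /LS /trace_nrm2; case: asboolP => // _.
rewrite addey// -ltNye; apply: (@lt_le_trans _ _ 0%E) => //.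
by apply: adde_ge0; apply: integral_ge0 => x _; rewrite lee_fin ?sqr_ge0 ?dotv_ge0.
Qed.

Lemma normB_no_trace tau v : ~ has_normal_trace Omega beta T tau ->
  normB Omega beta gamma omega tau v = +oo%E.
Proof.
move=> nt; rewrite /normB /trace_nrm2; case: asboolP => // _.
rewrite addey ?poweRyr ?invr_eq0 ?pnatr_eq0// -ltNye; apply: (@lt_le_trans _ _ 0%E) => //.
by apply: adde_ge0; apply: integral_ge0 => x _; rewrite lee_fin ?sqr_ge0 ?dotv_ge0.
Qed.

Lemma wnrm_image_best_approximation U Uh D :
  admissible U -> admissible Uh -> admissible D ->
  (forall t, LS Omega beta gamma omega f g U <=
             LS Omega beta gamma omega f g (pair_comb U t D))%E ->
  (forall t, LS Omega beta gamma omega f g Uh <=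
             LS Omega beta gamma omega f g (pair_comb Uh t D))%E ->
  (wnrm (ls_image (pair_comb U (-1) Uh)) <=
   wnrm (ls_image (pair_comb (pair_comb U (-1) Uh) (-1) D)))%E.
Proof.
move=> aU aUh aD hU hUh.
have eq2_le (a b a' b' : \bar R) : a = a' -> b = b' -> (a' <= b')%E -> (a <= b)%E.
  by move=> -> ->.
have iU := wL2_image aU; have iUh := wL2_image aUh; have iD := wL2_image aD.
have rU := wL2_comb mD mw (-1) iU wL2_data.
have rUh := wL2_comb mD mw (-1) iUh wL2_data.
have aE := admissible_comb (-1) aU aUh.
(* The difference of the two residuals, in which [ls_data] cancels. *)
pose r := comb (comb (ls_image U) (-1) ls_data) (-1) (comb (ls_image Uh) (-1) ls_data).
have mr : wL2 r by exact: (wL2_comb mD mw).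
have rE0 : r = comb (ls_image U) (-1) (ls_image Uh) by exact: comb_subK.
have rE i : {ae ls_measure i, forall x, ls_domain i x ->
    ls_image (pair_comb U (-1) Uh) i x = r i x}.
  apply: filterS (ls_image_comb (-1) aU aUh i) => x hx Dx.
  exact: etrans (hx Dx) (congr1 (fun h => h i x) (esym rE0)).
have e1 : wnrm (ls_image (pair_comb U (-1) Uh)) = wnrm r.
  exact: (wnrm_ae_eq mD mw (wL2_measurable (wL2_image aE)) (wL2_measurable mr) rE).
have e2 : wnrm (ls_image (pair_comb (pair_comb U (-1) Uh) (-1) D)) =
    wnrm (comb r (-1) (ls_image D)).
  apply: (wnrm_ae_eq mD mw (wL2_measurable (wL2_image (admissible_comb (-1) aE aD)))
                           (wL2_measurable (wL2_comb mD mw (-1) mr iD))) => i.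
  apply: filterS2 (ls_image_comb (-1) aE aD i) (rE i) => x hx hr Dx.
  exact: etrans (hx Dx) (congr1 (fun y => y + -1 * ls_image D i x) (hr Dx)).
apply: (eq2_le _ _ _ _ e1 e2).
apply: (wnrm_best_approximation mD mw ls_weight_ge0 rU rUh iD) => t.
- exact: (eq2_le _ _ _ _ (esym (LSE aU)) (esym (LS_comb t aU aD)) (hU t)).
- exact: (eq2_le _ _ _ _ (esym (LSE aUh)) (esym (LS_comb t aUh aD)) (hUh t)).
Qed.

Lemma normB_best_approximation (S : set ((V -> V) * (V -> R))) U Uh :
  (forall W, S W -> Hdiv Omega W.1 /\ L2 Omega W.2) ->
  (forall W t W', S W -> S W' -> S (pair_comb W t W')) ->
  S (cst 0, cst 0) ->
  minimizer [set tv | Sigma Omega beta T tv.1 /\ L2 Omega tv.2]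
    (LS Omega beta gamma omega f g) U ->
  minimizer S (LS Omega beta gamma omega f g) Uh ->
  forall W, S W ->
  (normB Omega beta gamma omega (U.1 \- Uh.1)%R (U.2 \- Uh.2)%R <=
   normB Omega beta gamma omega (U.1 \- W.1)%R (U.2 \- W.2)%R)%E.
Proof.
move=> SH Scomb S0 [aU minU] [SUh minUh] W SW.
have a0 : admissible (cst 0, cst 0) by split; [exact: Sigma0|exact: L2_0].
have aUh : admissible Uh.
  (* Without a trace, the functional at [Uh] would be infinite and exceed its finite value at
     zero. *)
  have [hd hv] := SH _ SUh; split=> //; split=> //; apply: contrapT => nt.
  have := le_lt_trans (minUh _ S0) (LS_lty a0).
  by rewrite LS_no_trace// ltxx.
have [hW|nW] := pselect (has_normal_trace Omega beta T W.1); last first.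
  suff nUW : ~ has_normal_trace Omega beta T (U.1 \- W.1)%R.
    by rewrite (normB_no_trace _ nUW) leey.
  (* [W] is [U] minus [U - W], so a trace of the difference would give one of [W]. *)
  move=> hUW; apply: nW.
  have sUW : Sigma Omega beta T (U.1 \- W.1)%R.
    split; last exact: hUW.
    have := Hdiv_comb oO bO (-1) aU.1.1 (SH _ SW).1; congr Hdiv.
    by apply/funext => x /=; rewrite scaleN1r.
  have := (Sigma_comb oO bO cb (-1) aU.1 sUW).2; congr has_normal_trace.
  by apply/funext => x /=; rewrite scaleN1r opprB addrC subrK.
have aW : admissible W by have [hd hv] := SH _ SW; split.
(* The discrete direction with [(U - Uh) - D = U - W]. *)
pose D := pair_comb W (-1) Uh.
have aD : admissible D by exact: admissible_comb.
have SD : S D by exact: Scomb.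
have aE : admissible (pair_comb U (-1) Uh) by exact: admissible_comb.
have aED : admissible (pair_comb (pair_comb U (-1) Uh) (-1) D).
  exact: admissible_comb.
have -> : (U.1 \- Uh.1)%R = (pair_comb U (-1) Uh).1.
  by apply/funext => x /=; rewrite scaleN1r.
have -> : (U.2 \- Uh.2)%R = (pair_comb U (-1) Uh).2.
  by apply/funext => x /=; rewrite mulN1r.
have -> : (U.1 \- W.1)%R = (pair_comb (pair_comb U (-1) Uh) (-1) D).1.
  by apply/funext => x /=; apply/rowP => j; rewrite !mxE; ring.
have -> : (U.2 \- W.2)%R = (pair_comb (pair_comb U (-1) Uh) (-1) D).2.
  by apply/funext => x /=; ring.
rewrite (normBE aE) (normBE aED).
have wnrm_ge0 h : (0 <= wnrm h)%E.
  apply: sume_ge0 => i _; apply: integral_ge0 => x Dx.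
  by rewrite lee_fin mulr_ge0 ?sqr_ge0 ?ls_weight_ge0.
have mono (a b : \bar R) : (0 <= a -> 0 <= b -> a <= b -> a `^ 2^-1 <= b `^ 2^-1)%E.
  move=> a0' b0 ab; apply: gt0_ler_poweR => //; rewrite ?invr_ge0//.
    by rewrite in_itv/= a0' leey.
  by rewrite in_itv/= b0 leey.
apply: (mono _ _ (wnrm_ge0 _) (wnrm_ge0 _)).
apply: (wnrm_image_best_approximation aU aUh aD) => t.
- by apply: minU; have [] := admissible_comb t aU aD.
- by apply: minUh; exact: Scomb.
Qed.

End least_squares_norm.

Theorem theorem6p1 (R : realType) (n : nat)
    (Omega : set 'rV[R]_n.+1)
    (beta : 'rV[R]_n.+1 -> 'rV[R]_n.+1) (gamma : 'rV[R]_n.+1 -> R)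
    (c : R) (f g : 'rV[R]_n.+1 -> R)
    (T : mesh R n) (kappa : R) (alpha : facet T -> R)
    (k i : nat)
    (sigma sigma_h : 'rV[R]_n.+1 -> 'rV[R]_n.+1) (u u_h : 'rV[R]_n.+1 -> R)
    (hOmega : bounded_polyhedral_lipschitz_domain Omega)
    (hbeta : C1_closure Omega beta)
    (hgamma : Linfty Omega gamma)
    (hcoer : {ae lebesgue_rV n.+1, forall x, Omega x ->
       0 <= gamma x + 2^-1 * divergence beta x})
    (hc : 0 < c)
    (hinflow : forall x, inflow Omega beta x -> c <= `|betan Omega beta x|)
    (hcase : assumption_i Omega beta \/ assumption_ii Omega beta gamma)
    (hf : L2 Omega f)
    (hg : measurable_fun (inflow Omega beta) g)
    (hg2 : (\sum_(F : facet T | inflow_facet Omega beta F)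
       \int[surf F]_(x in inflow Omega beta)
         (`|betan Omega beta x| * g x ^+ 2)%:E < +oo)%E)
    (hT : regular_triangulation Omega T kappa)
    (hcover : inflow_covered Omega beta T)
    (halpha : forall F, 0 < alpha F)
    (hi : i = 1%N \/ i = 2%N)
    (hmin : minimizer
       [set tv | Sigma Omega beta T tv.1 /\ L2 Omega tv.2]
       (LS Omega beta gamma (weight alpha i) f g) (sigma, u))
    (hmin_h : minimizer
       [set tv | RT Omega T k tv.1 /\ Pk Omega T k tv.2]
       (LS Omega beta gamma (weight alpha i) f g) (sigma_h, u_h)) :
  (normB Omega beta gamma (weight alpha i)
     (sigma \- sigma_h)%R (u \- u_h)%R <=
   ereal_inf [set normB Omega beta gamma (weight alpha i)
                    (sigma \- tv.1)%R (u \- tv.2)%R |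
      tv in [set tv | RT Omega T k tv.1 /\ Pk Omega T k tv.2]])%E.
Proof.
have [oO _ _ bO _] := hOmega; have [cb _] := hbeta.
have w0 F : 0 <= weight alpha i F.
  by rewrite /weight; case: ifP => // _; rewrite mulr_ge0 ?diam_ge0// ltW.
apply: le_ereal_inf_tmp => _ [W SW <-].
apply: (normB_best_approximation oO bO cb hgamma hc hinflow hf hg hg2 w0 _ _ _
  hmin hmin_h SW).
- by move=> W' [[hd _] [hv _]].
- by move=> W1 t W2 [h1 h2] [h1' h2']; split; [exact: RT_comb|exact: Pk_comb].
- by split; [exact: RT0|exact: Pk0].
Qed.
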